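(* Let $k$ be an algebraically closed field and let $A$ be a noetherian AS-Gorenstein Hopf $k$-algebra of finite global dimension with bijective antipode $S$. Let $io(A)$ be the integral order and $o(A)$ the Nakayama order of $A$, and let $\nu$ be the Nakayama automorphism of $A$. (a) The Nakayama order $o(A)$ is equal to either $io(A)$ or $2\,io(A)$. (b) Suppose $io(A)$ is finite. Then $S^{4\,io(A)}$ is an inner automorphism. (c) Suppose $A$ is a finite module over its centre. Then the antipode $S$ and the Nakayama automorphism $\nu$ are of finite order up to inner automorphisms (that is, some positive power of each is an inner automorphism of $A$).
   Context: Algebras are associative unital $k$-algebras; noetherian means left and right noetherian; $A^e=A\otimes_kA^{\mathrm{op}}$; $k$ also denotes the trivial module $A/\ker\epsilon$, $\epsilon$ the counit; $\Delta(a)=\sum a_1\otimes a_2$. AS-Gorenstein: a noetherian algebra $A$ with augmentation $\epsilon:A\to k$ is AS-Gorenstein (of injective dimension $d$) if (AS1) $\operatorname{injdim}({}_AA)=d<\infty$; (AS2) $\dim_k\operatorname{Ext}^d_A({}_Ak,{}_AA)=1$ and $\operatorname{Ext}^i_A({}_Ak,{}_AA)=0$ for all $i\ne d$; (AS3) the right-module versions hold. Let $\pi_0:A\to k$ be the algebra homomorphism through which $A$ acts on the one-dimensional right $A$-module $\operatorname{Ext}^d_A({}_Ak,{}_AA)$, and $\xi(a)=\sum\pi_0(a_1)a_2$ the associated left winding automorphism. The integral order $io(A)\in\{1,2,\dots\}\cup\{\infty\}$ is the order of $\xi$ (equivalently, of $\pi_0$ in the group of algebra homomorphisms $A\to k$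 under convolution). Nakayama automorphism: an algebra automorphism $\nu$ of $A$ with $\operatorname{Ext}^i_{A^e}(A,A^e)=0$ for $i\neq d$ and $\operatorname{Ext}^d_{A^e}(A,A^e)\cong{}^1A^{\nu}$ as bimodules, where ${}^1A^{\nu}$ is $A$ with $a\cdot m\cdot b=am\nu(b)$. For the algebras here it exists and is unique up to inner automorphisms. The Nakayama order $o(A)$ is the smallest positive integer $n$ such that $\nu^n$ is inner, or $\infty$ if no such $n$ exists. If $io(A)=\infty$, statement (a) means $o(A)=\infty$. *)

(* Defs.v *)
From HB Require Import structures.
From mathcomp Require Import all_boot all_order all_algebra generic_quotient.
From mathcomp Require Import boolp.
Set Implicit Arguments.
Unset Strict Implicit.
Unset Printing Implicit Defensive.
Import GRing.Theory.
Local Open Scope ring_scope.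

(* Conventions: a left R-module is an [lmodType R], a right R-module is an    *)
(* [lmodType R^c] with R^c the opposite ring, and the free module of rank one *)
(* is R^o.                                                                    *)

Section Bilinear.
Variables (K : comNzRingType) (U V W : lmodType K).

Definition is_bilinear (f : U -> V -> W) : Prop :=
  (forall c u u' v, f (c *: u + u') v = c *: f u v + f u' v) /\
  (forall c u v v', f u (c *: v + v') = c *: f u v + f u v').

Definition eval_formal (f : U -> V -> W) (s : seq (U * V)) : W :=
  \sum_(p <- s) f p.1 p.2.

Lemma bilinDl f : is_bilinear f ->
  forall u u' v, f (u + u') v = f u v + f u' v.
Proof. by move=> [fl _] u u' v; have := fl 1 u u' v; rewrite !scale1r. Qed.

Lemma bilinDr f : is_bilinear f ->
  forall u v v', f u (v + v') = f u v + f u v'.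
Proof. by move=> [_ fr] u v v'; have := fr 1 u v v'; rewrite !scale1r. Qed.

Lemma bilin0l f : is_bilinear f -> forall v, f 0 v = 0.
Proof.
by move=> bf v; apply: (addrI (f 0 v)); rewrite -(bilinDl bf) !addr0.
Qed.

Lemma bilin0r f : is_bilinear f -> forall u, f u 0 = 0.
Proof.
by move=> bf u; apply: (addrI (f u 0)); rewrite -(bilinDr bf) !addr0.
Qed.

Lemma bilinZl f : is_bilinear f -> forall c u v, f (c *: u) v = c *: f u v.
Proof.
by move=> bf c u v; have := bf.1 c u 0 v; rewrite (bilin0l bf) !addr0.
Qed.

Lemma bilinZr f : is_bilinear f -> forall c u v, f u (c *: v) = c *: f u v.
Proof.
by move=> bf c u v; have := bf.2 c u v 0; rewrite (bilin0r bf) !addr0.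
Qed.

End Bilinear.

Section Tensor.
Variables (K : comNzRingType) (U V : lmodType K).

(* A list of pairs (u_i, v_i) stands for the formal sum of the u_i (x) v_i;   *)
(* two formal sums are identified when no bilinear map separates them.        *)
Definition tensor_eq (s t : seq (U * V)) : bool :=
  `[< forall (W : lmodType K) (f : U -> V -> W), is_bilinear f ->
        eval_formal f s = eval_formal f t >].

Lemma tensor_eq_refl : reflexive tensor_eq.
Proof. by move=> s; apply/asboolP. Qed.

Lemma tensor_eq_sym : symmetric tensor_eq.
Proof.
by move=> s t; apply/asboolP/asboolP => h W f bf; rewrite h.
Qed.

Lemma tensor_eq_trans : transitive tensor_eq.
Proof.
move=> t s u /asboolP st /asboolP tu; apply/asboolP => W f bf.
by rewrite st // tu.
Qed.

Canonical tensor_equiv :=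
  EquivRel tensor_eq tensor_eq_refl tensor_eq_sym tensor_eq_trans.

Definition tensor : Type := {eq_quot tensor_equiv}%qT.
HB.instance Definition _ := Choice.on tensor.

Definition formal (s : seq (U * V)) : tensor :=
  (\pi_({eq_quot tensor_equiv}) s)%qT.
Definition trepr (t : tensor) : seq (U * V) :=
  repr (t : {eq_quot tensor_equiv}%qT).
Definition tens (u : U) (v : V) : tensor := formal [:: (u, v)].

(* The linear map on the tensor product induced by a bilinear map f; applied  *)
(* to a coproduct this is Sweedler's notation \sum f a_1 a_2.                 *)
Definition tlift (W : lmodType K) (f : U -> V -> W) (t : tensor) : W :=
  eval_formal f (trepr t).

Lemma formal_eqP s t :
  formal s = formal t <->
  forall (W : lmodType K) (f : U -> V -> W), is_bilinear f ->
    eval_formal f s = eval_formal f t.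
Proof.
split=> [/eqmodP/asboolP //|h].
by apply/eqmodP/asboolP.
Qed.

Lemma formal_repr t : formal (trepr t) = t.
Proof. exact: reprK. Qed.

Lemma tlift_formal (W : lmodType K) (f : U -> V -> W) s :
  is_bilinear f -> tlift f (formal s) = eval_formal f s.
Proof.
move=> bf; rewrite /tlift.
by apply: (proj1 (formal_eqP _ s)) => //; rewrite formal_repr.
Qed.

Lemma tensor_extP x y :
  (forall (W : lmodType K) (f : U -> V -> W), is_bilinear f ->
     tlift f x = tlift f y) -> x = y.
Proof.
move=> h; rewrite -[x]formal_repr -[y]formal_repr.
by apply/formal_eqP => W f bf; apply: h.
Qed.

Definition tadd (x y : tensor) := formal (trepr x ++ trepr y).
Definition tscale (c : K) (x : tensor) :=
  formal [seq (c *: p.1, p.2) | p <- trepr x].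
Definition topp (x : tensor) := tscale (-1) x.
Definition tzero : tensor := formal [::].

Section Evaluation.
Variables (W : lmodType K) (f : U -> V -> W).
Hypothesis bf : is_bilinear f.

Lemma tlift_tzero : tlift f tzero = 0.
Proof. by rewrite tlift_formal // /eval_formal big_nil. Qed.

Lemma tlift_tadd x y : tlift f (tadd x y) = tlift f x + tlift f y.
Proof. by rewrite tlift_formal // /eval_formal big_cat. Qed.

Lemma tlift_tscale c x : tlift f (tscale c x) = c *: tlift f x.
Proof.
rewrite tlift_formal // /tlift /eval_formal big_map scaler_sumr.
by apply: eq_bigr => p _ /=; rewrite (bilinZl bf).
Qed.

Lemma tlift_topp x : tlift f (topp x) = - tlift f x.
Proof. by rewrite tlift_tscale scaleN1r. Qed.

Lemma tlift_tens u v : tlift f (tens u v) = f u v.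
Proof. by rewrite tlift_formal // /eval_formal big_seq1. Qed.

End Evaluation.

Lemma taddA : associative tadd.
Proof.
by move=> x y z; apply: tensor_extP => W f bf; rewrite !tlift_tadd // addrA.
Qed.

Lemma taddC : commutative tadd.
Proof.
by move=> x y; apply: tensor_extP => W f bf; rewrite !tlift_tadd // addrC.
Qed.

Lemma tadd0 : left_id tzero tadd.
Proof.
move=> x; apply: tensor_extP => W f bf.
by rewrite tlift_tadd // tlift_tzero // add0r.
Qed.

Lemma taddN : left_inverse tzero topp tadd.
Proof.
move=> x; apply: tensor_extP => W f bf.
by rewrite tlift_tadd // tlift_topp // tlift_tzero // addNr.
Qed.

HB.instance Definition _ := GRing.isZmodule.Build tensor taddA taddC tadd0 taddN.

Lemma tscaleA a b x : tscale a (tscale b x) = tscale (a * b) x.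
Proof.
by apply: tensor_extP => W f bf; rewrite !tlift_tscale // scalerA.
Qed.

Lemma tscale1 : left_id 1 tscale.
Proof.
by move=> x; apply: tensor_extP => W f bf; rewrite tlift_tscale // scale1r.
Qed.

Lemma tscaleDr : right_distributive tscale +%R.
Proof.
move=> c x y; apply: tensor_extP => W f bf.
by rewrite tlift_tadd // !tlift_tscale // tlift_tadd // scalerDr.
Qed.

Lemma tscaleDl x : {morph tscale^~ x : a b / a + b}.
Proof.
move=> a b; apply: tensor_extP => W f bf /=.
by rewrite tlift_tadd // !tlift_tscale // scalerDl.
Qed.

HB.instance Definition _ := GRing.Zmodule_isLmodule.Build K tensor
  tscaleA tscale1 tscaleDr tscaleDl.

Section Lift.
Variables (W : lmodType K) (f : U -> V -> W).
Hypothesis bf : is_bilinear f.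

Lemma tliftP c x y : tlift f (c *: x + y) = c *: tlift f x + tlift f y.
Proof. by rewrite tlift_tadd // tlift_tscale. Qed.

Lemma tliftD x y : tlift f (x + y) = tlift f x + tlift f y.
Proof. exact: tlift_tadd. Qed.

Lemma tlift_sum (I : Type) (r : seq I) (F : I -> tensor) :
  tlift f (\sum_(i <- r) F i) = \sum_(i <- r) tlift f (F i).
Proof.
elim: r => [|i r ih]; first by rewrite !big_nil tlift_tzero.
by rewrite !big_cons tliftD ih.
Qed.

End Lift.

Lemma tens_bilinear : is_bilinear tens.
Proof.
split=> c x y z; apply: tensor_extP => W f bf;
  by rewrite tliftP // !tlift_tens // ?(bf.1) ?(bf.2).
Qed.

Lemma tensor_sum x : x = \sum_(p <- trepr x) tens p.1 p.2.
Proof.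
apply: tensor_extP => W f bf; rewrite tlift_sum //.
by under [RHS]eq_bigr do rewrite tlift_tens //.
Qed.

Lemma tensor_universal (W : lmodType K) (f : U -> V -> W) :
  is_bilinear f ->
  exists! g : tensor -> W, linear g /\ forall u v, g (tens u v) = f u v.
Proof.
move=> bf; exists (tlift f); split.
  by split=> [c x y|u v]; [rewrite tliftP | rewrite tlift_tens].
move=> g [gl gt]; apply/funext => x.
have g0 : g 0 = 0.
  by have := gl (-1) 0 0; rewrite scaler0 addr0 scaleN1r addNr.
have gD y z : g (y + z) = g y + g z by have := gl 1 y z; rewrite !scale1r.
rewrite {2}[x]tensor_sum /tlift /eval_formal (big_morph g gD g0).
by apply: eq_bigr => p _; rewrite gt.
Qed.

Lemma tensor_lin_ext (W : lmodType K) (g h : tensor -> W) :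
  linear g -> linear h -> (forall u v, g (tens u v) = h (tens u v)) -> g =1 h.
Proof.
move=> gl hl gh x.
have bf : is_bilinear (fun u v => g (tens u v)).
  by split=> c x1 x2 x3; rewrite (tens_bilinear.1, tens_bilinear.2) gl.
have [e [_ eu]] := tensor_universal bf.
have -> : g = e by symmetry; apply: eu.
by have -> : h = e by symmetry; apply: eu; split=> // u v; rewrite gh.
Qed.

End Tensor.

Arguments tens {K U V} u v.
Arguments tlift {K U V W} f t.

Lemma tlift_bilinear (K : comNzRingType) (U V X Y W : lmodType K)
    (F : X -> Y -> U -> V -> W) (t : tensor U V) :
  (forall u v, is_bilinear (fun x y => F x y u v)) ->
  is_bilinear (fun x y => tlift (F x y) t).
Proof.
move=> bF; split=> c x y z; rewrite /tlift /eval_formal scaler_sumr -big_split.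
  by apply: eq_bigr => p _; rewrite (bF _ _).1.
by apply: eq_bigr => p _; rewrite (bF _ _).2.
Qed.

Section Opposite.
Variables (K : comNzRingType) (A : algType K).

HB.instance Definition _ := GRing.Nmodule_isLSemiModule.Build K A^c
  (@scalerA K A) (@scale0r K A) (@scale1r K A) (@scalerDr K A) (@scalerDl K A).

Lemma conv_scalerAl (c : K) (u v : A^c) : c *: (u * v) = (c *: u) * v.
Proof. exact: (@scalerAr K A). Qed.

Lemma conv_scalerAr (c : K) (u v : A^c) : c *: (u * v) = u * (c *: v).
Proof. exact: (@scalerAl K A). Qed.

HB.instance Definition _ :=
  GRing.LSemiModule_isLSemiAlgebra.Build K A^c conv_scalerAl.
HB.instance Definition _ :=
  GRing.LSemiAlgebra_isSemiAlgebra.Build K A^c conv_scalerAr.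

End Opposite.

Section TensorAlgebra.
Variables (K : comNzRingType) (A B : algType K).
Local Notation T := (tensor A B).

Definition tmul (x y : T) : T :=
  tlift (fun a b => tlift (fun c d => tens (a * c) (b * d)) y) x.
Definition tone : T := tens 1 1.

Let bil_in a b :
  is_bilinear (fun (c : A) (d : B) => tens (a * c) (b * d) : T).
Proof.
split=> e x y z; rewrite mulrDr -scalerAr;
by rewrite (tens_bilinear _ _).1 || rewrite (tens_bilinear _ _).2.
Qed.

Let bil_out (y : T) :
  is_bilinear (fun a b => tlift (fun c d => tens (a * c) (b * d)) y : T).
Proof.
apply: tlift_bilinear => c d; split=> e x y' z; rewrite mulrDl -scalerAl;
by rewrite (tens_bilinear _ _).1 || rewrite (tens_bilinear _ _).2.
Qed.

Lemma tmul_tens a b c d : tmul (tens a b) (tens c d) = tens (a * c) (b * d).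
Proof. by rewrite /tmul !tlift_tens. Qed.

Lemma tmul_linl y : linear (tmul^~ y).
Proof. by move=> c x x'; exact: (tliftP (bil_out y)). Qed.

Lemma tmul_linr x : linear (tmul x).
Proof.
move=> c y y'; rewrite /tmul {1 2 3}/tlift /eval_formal scaler_sumr -big_split.
by apply: eq_bigr => p _; exact: (tliftP (bil_in _ _)).
Qed.

Lemma tmulA : associative tmul.
Proof.
move=> x y z.
move: x; apply: tensor_lin_ext => [||a b].
- by move=> e x x'; rewrite tmul_linl.
- by move=> e x x'; rewrite !tmul_linl.
move: y; apply: tensor_lin_ext => [||c d].
- by move=> e x x'; rewrite tmul_linl tmul_linr.
- by move=> e x x'; rewrite tmul_linr tmul_linl.
move: z; apply: tensor_lin_ext => [||e f].
- by move=> g x x'; rewrite !tmul_linr.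
- by move=> g x x'; rewrite !tmul_linr.
by rewrite !tmul_tens !mulrA.
Qed.

Lemma tmul1 : left_id tone tmul.
Proof.
apply: tensor_lin_ext => [||a b]; [exact: tmul_linr | by [] |].
by rewrite tmul_tens !mul1r.
Qed.

Lemma tmulr1 : right_id tone tmul.
Proof.
apply: tensor_lin_ext => [||a b]; [exact: tmul_linl | by [] |].
by rewrite tmul_tens !mulr1.
Qed.

Lemma tmulDl : left_distributive tmul +%R.
Proof. by move=> x y z; have := tmul_linl z 1 x y; rewrite !scale1r. Qed.

Lemma tmulDr : right_distributive tmul +%R.
Proof. by move=> x y z; have := tmul_linr x 1 y z; rewrite !scale1r. Qed.

HB.instance Definition _ := GRing.Zmodule_isPzRing.Build (tensor A B)
  tmulA tmul1 tmulr1 tmulDl tmulDr.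

End TensorAlgebra.

Notation envelop A := (tensor A A^c).

Section Bimodule.
Variables (K : comNzRingType) (A : algType K).

(* A with the left A^e-action (a (x) b) m = a m b. *)
Definition bimod : Type := A.
HB.instance Definition _ := GRing.Zmodule.on bimod.

Definition bimod_scale (t : envelop A) (m : bimod) : bimod :=
  tlift (fun (a : A) (b : A^c) => a * (m : A) * (b : A)) t.

Let bil m : is_bilinear (fun (a : A) (b : A^c) => a * m * (b : A)).
Proof.
split=> c x y z; first by rewrite !mulrDl -!scalerAl.
by rewrite mulrDr -scalerAr.
Qed.

Lemma bimod_scale_tens (a : A) (b : A^c) (m : A) :
  bimod_scale (tens a b) m = a * m * (b : A).
Proof. by rewrite /bimod_scale tlift_tens. Qed.

Lemma bimod_scale_lin m : linear (fun t => bimod_scale t m : A).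
Proof. by move=> c x y; rewrite /bimod_scale tliftP. Qed.

Lemma bimod_scale_linr t (c : K) (m m' : A) :
  bimod_scale t (c *: m + m') = c *: (bimod_scale t m : A) + bimod_scale t m'.
Proof.
rewrite /bimod_scale /tlift /eval_formal scaler_sumr -big_split.
by apply: eq_bigr => p _; rewrite mulrDr mulrDl -scalerAr -scalerAl.
Qed.

Lemma bimod_scaleA s t m :
  bimod_scale s (bimod_scale t m) = bimod_scale (s * t) m.
Proof.
move: s; apply: tensor_lin_ext => [||a b].
- by move=> c x y; rewrite bimod_scale_lin.
- by move=> c x y; rewrite [_ * t]tmul_linl bimod_scale_lin.
move: t; apply: tensor_lin_ext => [||c d].
- by move=> c x y; rewrite bimod_scale_lin bimod_scale_linr.
- by move=> c x y; rewrite [_ * _]tmul_linr bimod_scale_lin.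
by rewrite [_ * _]tmul_tens !bimod_scale_tens !mulrA.
Qed.

Lemma bimod_scale1 : left_id 1 bimod_scale.
Proof. by move=> m; rewrite bimod_scale_tens mul1r mulr1. Qed.

Lemma bimod_scaleDr : right_distributive bimod_scale +%R.
Proof.
by move=> t m m'; have := bimod_scale_linr t 1 m m'; rewrite !scale1r.
Qed.

Lemma bimod_scaleDl m : {morph bimod_scale^~ m : s t / s + t}.
Proof.
by move=> s t; have := bimod_scale_lin m 1 s t; rewrite !scale1r.
Qed.

HB.instance Definition _ := GRing.Zmodule_isLmodule.Build (envelop A) bimod
  bimod_scaleA bimod_scale1 bimod_scaleDr bimod_scaleDl.

End Bimodule.

Section Character.
Variables (K : comNzRingType) (B : algType K).

Section Module.
Variable e : {lrmorphism B -> K^o}.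

Definition char_mod : Type := let _ := e in K.
HB.instance Definition _ := GRing.Zmodule.on char_mod.

Definition char_scale (b : B) (x : char_mod) : char_mod := (e b : K) * (x : K).

Lemma char_scaleA a b x :
  char_scale a (char_scale b x) = char_scale (a * b) x.
Proof. by rewrite /char_scale rmorphM mulrA. Qed.

Lemma char_scale1 : left_id 1 char_scale.
Proof. by move=> x; rewrite /char_scale rmorph1 mul1r. Qed.

Lemma char_scaleDr : right_distributive char_scale +%R.
Proof. by move=> a x y; exact: (@mulrDr K). Qed.

Lemma char_scaleDl x : {morph char_scale^~ x : a b / a + b}.
Proof. by move=> a b; rewrite /char_scale rmorphD; exact: (@mulrDl K). Qed.

HB.instance Definition _ := GRing.Zmodule_isLmodule.Build B char_mod
  char_scaleA char_scale1 char_scaleDr char_scaleDl.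

End Module.

Definition conv_fun (e : {lrmorphism B -> K^o}) : B^c -> K^o := e.

Section Conv.
Variable e : {lrmorphism B -> K^o}.

Lemma conv_fun_linear : linear (conv_fun e).
Proof. by move=> c x y; rewrite /conv_fun linearP. Qed.

Lemma conv_fun_monoid : monoid_morphism (conv_fun e).
Proof.
split; first exact: rmorph1.
move=> x y; exact: etrans (rmorphM e (y : B) (x : B)) (@mulrC K _ _).
Qed.

HB.instance Definition _ :=
  GRing.isLinear.Build K B^c K^o *:%R (conv_fun e) conv_fun_linear.
HB.instance Definition _ :=
  GRing.isMonoidMorphism.Build B^c K^o (conv_fun e) conv_fun_monoid.

Definition conv_char : {lrmorphism B^c -> K^o} := conv_fun e.

End Conv.

End Character.

Section Homological.
Variable R : pzRingType.

Definition left_ideal (I : R -> Prop) : Prop :=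
  [/\ I 0, forall x y, I x -> I y -> I (x + y) & forall r x, I x -> I (r * x)].

Definition left_noetherian : Prop :=
  forall I : nat -> R -> Prop,
    (forall n, left_ideal (I n)) -> (forall n x, I n x -> I n.+1 x) ->
    exists N, forall n x, (N <= n)%N -> I n x -> I N x.

Definition projective (P : lmodType R) : Prop :=
  forall (X Y : lmodType R) (g : {linear X -> Y}) (f : {linear P -> Y}),
    (forall y, exists x, g x = y) ->
    exists h : {linear P -> X}, forall p, g (h p) = f p.

Definition injective_mod (I : lmodType R) : Prop :=
  forall (X Y : lmodType R) (g : {linear X -> Y}) (f : {linear X -> I}),
    injective g -> exists h : {linear Y -> I}, forall x, h (g x) = f x.

Record proj_resolution (M : lmodType R) := ProjResolution {
  pres :> nat -> lmodType R;
  pdiff : forall n, {linear pres n.+1 -> pres n};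
  paug : {linear pres 0%N -> M};
  pres_projective : forall n, projective (pres n);
  paug_surj : forall m, exists p, paug p = m;
  pres_exact0 : forall p, paug p = 0 <-> exists q, pdiff 0 q = p;
  pres_exact : forall n p, pdiff n p = 0 <-> exists q, pdiff n.+1 q = p
}.

Record inj_resolution (N : lmodType R) := InjResolution {
  ires :> nat -> lmodType R;
  idiff : forall n, {linear ires n -> ires n.+1};
  iaug : {linear N -> ires 0%N};
  ires_injective : forall n, injective_mod (ires n);
  iaug_inj : injective iaug;
  ires_exact0 : forall x, idiff 0 x = 0 <-> exists y, iaug y = x;
  ires_exact : forall n x, idiff n.+1 x = 0 <-> exists y, idiff n y = x
}.

Definition projdim_le (M : lmodType R) (n : nat) : Prop :=
  exists P : proj_resolution M, forall m (x : P m), (n < m)%N -> x = 0.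

Definition injdim_le (N : lmodType R) (n : nat) : Prop :=
  exists I : inj_resolution N, forall m (x : I m), (n < m)%N -> x = 0.

Definition injdim_eq (N : lmodType R) (d : nat) : Prop :=
  injdim_le N d /\ forall n, injdim_le N n -> (d <= n)%N.

Definition finite_gldim : Prop :=
  exists n, forall M : lmodType R, projdim_le M n.

Section Ext.
Variables M N : lmodType R.

Definition cocycle (P : proj_resolution M) i (f : {linear P i -> N}) : Prop :=
  forall q, f (pdiff P i q) = 0.

Definition coboundary (P : proj_resolution M) i :
    {linear P i -> N} -> Prop :=
  match i with
  | 0 => fun f => forall x, f x = 0
  | j.+1 => fun f => exists g : {linear P j -> N}, forall x, f x = g (pdiff P j x)
  end.

Definition Ext_zero (i : nat) : Prop :=
  exists P : proj_resolution M,
    forall f : {linear P i -> N}, cocycle f -> coboundary f.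

(* Ext^i_R(M, N) is isomorphic to E.  T is a set of operators acting by       *)
(* R-linear maps on N, hence on Ext^i_R(M, N), and actE is its action on E.   *)
(* The isomorphism is given as the T-equivariant homomorphism phi from        *)
(* cocycles onto E whose kernel is the group of coboundaries.                 *)
Definition Ext_iso (i : nat) (T : Type) (act : T -> N -> N)
    (E : zmodType) (actE : T -> E -> E) : Prop :=
  exists (P : proj_resolution M) (phi : {linear P i -> N} -> E),
  [/\ forall f g h : {linear P i -> N}, cocycle f -> cocycle g ->
        (forall x, h x = f x + g x) -> phi h = phi f + phi g,
      forall t (f h : {linear P i -> N}), cocycle f ->
        (forall x, h x = act t (f x)) -> phi h = actE t (phi f),
      forall e : E, exists2 f : {linear P i -> N}, cocycle f & phi f = e
    & forall f : {linear P i -> N}, cocycle f -> (phi f = 0 <-> coboundary f)].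

End Ext.

End Homological.

Arguments Ext_zero {R} M N i.
Arguments Ext_iso {R} M N i {T} act E actE.

Section ASGorenstein.
Variables (K : comNzRingType).

Definition left_AS (B : algType K) (e : {lrmorphism B -> K^o}) (d : nat) : Prop :=
  [/\ injdim_eq B^o d,
      Ext_iso (char_mod e) B^o d
        (fun (c : K) (y : B) => c *: y) K (fun c x => c * x)
    & forall i, i <> d -> Ext_zero (char_mod e) B^o i].

Variables (A : algType K).

Definition noetherian : Prop := left_noetherian A /\ left_noetherian A^c.

Definition AS_Gorenstein (e : {lrmorphism A -> K^o}) (d : nat) : Prop :=
  [/\ noetherian, left_AS e d & @left_AS A^c (conv_char e) d].

(* The right A-module Ext^d_A(k, A) is one-dimensional with A acting by pi0. *)
Definition integral_character (e : {lrmorphism A -> K^o}) (d : nat)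
    (pi0 : {lrmorphism A -> K^o}) : Prop :=
  Ext_iso (char_mod e) A^o d
    (fun (a : A) (y : A) => y * a) K (fun a x => x * (pi0 a : K)).

(* A^e acts on the right of A^e by multiplication, which makes                *)
(* Ext_(A^e)(A, A^e) a right A^e-module, i.e. a bimodule; a . m . b is the    *)
(* right action of b (x) a on m.                                              *)
Definition nakayama_automorphism (d : nat) (nu : {lrmorphism A -> A}) : Prop :=
  [/\ bijective nu,
      forall i, i <> d -> Ext_zero (bimod A) (envelop A)^o i
    & Ext_iso (bimod A) (envelop A)^o d
        (fun (p : A * A) (y : envelop A) => y * tens p.2 (p.1 : A^c))
        A (fun p m => p.1 * m * nu p.2)].

Definition is_inner (f : A -> A) : Prop :=
  exists u v : A, [/\ u * v = 1, v * u = 1 & forall a, f a = u * a * v].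

Definition finite_over_center : Prop :=
  exists s : seq A, forall a, exists2 z : nat -> A,
    (forall i b, z i * b = b * z i) & a = \sum_(i < size s) z i * s`_i.

End ASGorenstein.

Record hopf_structure (K : comNzRingType) (A : algType K) := HopfStructure {
  comul : {linear A -> tensor A A};
  counit : {lrmorphism A -> K^o};
  antipode : {linear A -> A};
  comul_monoid : monoid_morphism comul;
  comulA : forall a,
    tlift (fun a1 a2 => tlift (fun b1 b2 => tens b1 (tens b2 a2)) (comul a1))
      (comul a) = tlift (fun a1 a2 => tens a1 (comul a2)) (comul a);
  counitl : forall a, tlift (fun a1 a2 => (counit a1 : K) *: a2) (comul a) = a;
  counitr : forall a, tlift (fun a1 a2 => (counit a2 : K) *: a1) (comul a) = a;
  antipodel : forall a,
    tlift (fun a1 a2 => antipode a1 * a2) (comul a) = (counit a : K)%:A;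
  antipoder : forall a,
    tlift (fun a1 a2 => a1 * antipode a2) (comul a) = (counit a : K)%:A
}.

Definition left_winding (K : comNzRingType) (A : algType K)
    (H : hopf_structure A) (pi0 : {lrmorphism A -> K^o}) (a : A) : A :=
  tlift (fun a1 a2 => (pi0 a1 : K) *: a2) (comul H a).

(* None stands for infinite order. *)
Definition least_pos (P : nat -> Prop) : option nat :=
  if pselect (exists n, (0 < n)%N && `[< P n >]) is left h
  then Some (ex_minn h) else None.

Definition integral_order (K : comNzRingType) (A : algType K)
    (H : hopf_structure A) (pi0 : {lrmorphism A -> K^o}) : option nat :=
  least_pos (fun n => forall a, iter n (left_winding H pi0) a = a).

Definition nakayama_order (K : comNzRingType) (A : algType K)
    (nu : {lrmorphism A -> A}) : option nat :=
  least_pos (fun n => is_inner (iter n nu)).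

(* Main.v *)
(** Write [R = A (x) A^op] and let [delta a = a_1 (x) S a_2 : A -> R], so that
    [A = R (x)_A k] along [delta].  A resolution [P] of the trivial module by
    finite free [A]-modules, i.e. a sequence of matrices over [A], becomes a
    resolution of the bimodule [A] when [delta] is applied to the entries.  If
    [f] is a cocycle generating [Ext^d_A(k, A)], then [delta f] is a cocycle with
    [delta f . delta a = pi0(a) delta f]; as [R] is free over [A] on both sides
    and [P] is finite in each degree, its class generates [Ext^d_R(A, R)].  Under
    [Ext^d_R(A, R) = ^1A^nu] this class is a unit [c] with
    [\sum S(a_2) c nu(a_1) = pi0(a) c], whence [nu = S^2 xi] modulo inner
    automorphisms.

    The automorphism [a (x) b |-> S b (x) S a] of [R] carries the bimodule [A] to
    itself via [S]; transporting [Ext^d_R(A, R)] along it gives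
    [S nu S^-1 = nu^-1] modulo inner automorphisms.  These two relations show that
    [xi^m = 1] makes [S^(4m)] and [nu^(2m)] inner.  Conversely, characters of [A]
    ignore inner automorphisms and [S^2], so [nu^n] inner gives
    [eps xi^n = eps], that is [xi^n = 1].

    Finally [nu] fixes the centre, since a central [z] acts on [Ext_R(A, R)] the
    same way from both sides.  If [A] is finite over its centre, the characters
    [eps nu^n] agree there, so only finitely many are distinct and [xi] has finite
    order. *)
From HB Require Import structures.
Require Import Defs.
From mathcomp Require Import all_boot all_order all_algebra.
From mathcomp Require Import ring boolp classical_sets.
Set Implicit Arguments.
Unset Strict Implicit.
Unset Printing Implicit Defensive.
Import GRing.Theory.
Local Open Scope ring_scope.

(** * Resolutions and Ext *)

Section Restrict.
Variables (R S : pzRingType) (f : {rmorphism R -> S}) (M : lmodType S).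

(** The vacuous [let] keeps [f] in the type, so that instance inference can recover which scalar
    action is meant. *)
Definition restrict : Type := let _ := f in M.
HB.instance Definition _ := GRing.Zmodule.on restrict.

Definition restrict_scale (r : R) (m : restrict) : restrict := f r *: (m : M).

Lemma restrict_scaleA a b m :
  restrict_scale a (restrict_scale b m) = restrict_scale (a * b) m.
Proof. by rewrite /restrict_scale scalerA rmorphM. Qed.

Lemma restrict_scale1 : left_id 1 restrict_scale.
Proof. by move=> m; rewrite /restrict_scale rmorph1 scale1r. Qed.

Lemma restrict_scaleDr : right_distributive restrict_scale +%R.
Proof. by move=> a m n; rewrite /restrict_scale -[LHS]/(f a *: ((m : M) + n)) scalerDr. Qed.

Lemma restrict_scaleDl m : {morph restrict_scale^~ m : a b / a + b}.
Proof. by move=> a b; rewrite /restrict_scale rmorphD scalerDl. Qed.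

HB.instance Definition _ := GRing.Zmodule_isLmodule.Build R restrict
  restrict_scaleA restrict_scale1 restrict_scaleDr restrict_scaleDl.

Lemma restrictZE (r : R) (m : restrict) : r *: m = f r *: (m : M).
Proof. by []. Qed.

End Restrict.

(** * Lifting from a projective module through maps that need not be onto *)

Section Image.
Variables (R : pzRingType) (X Y : lmodType R) (f : {linear X -> Y}).

Definition image_pred : {pred Y} := [pred y | `[< exists x, f x = y >]].

Lemma image_submod : submod_closed image_pred.
Proof.
split; first by apply/asboolP; exists 0; rewrite raddf0.
move=> a u v /asboolP[x <-] /asboolP[y <-]; apply/asboolP.
by exists (a *: x + y); rewrite linearP.
Qed.

HB.instance Definition _ := GRing.isSubmodClosed.Build R Y image_pred image_submod.

Definition image_mod : Type := {y : Y | y \in image_pred}.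
HB.instance Definition _ := SubChoice.on image_mod.
HB.instance Definition _ := [SubChoice_isSubLmodule of image_mod by <:].

Lemma mem_image (x : X) : f x \in image_pred.
Proof. by apply/asboolP; exists x. Qed.

End Image.

(** [projective] only speaks of surjections, so both [f] and [g] are corestricted to the image of
    [g], where [g] becomes onto. *)
Lemma projective_lift (R : pzRingType) (P X Y : lmodType R)
    (g : {linear X -> Y}) (f : {linear P -> Y}) :
  projective P -> (forall p, exists x, g x = f p) ->
  exists h : {linear P -> X}, forall p, g (h p) = f p.
Proof.
move=> projP fg.
have fin p : f p \in image_pred g by have [x <-] := fg p; apply: mem_image.
pose f' (p : P) : image_mod g := Sub (f p) (fin p).
pose g' (x : X) : image_mod g := Sub (g x) (mem_image g x).
have f'L : linear f' by move=> c x y; apply: val_inj; rewrite /= linearP.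
have g'L : linear g' by move=> c x y; apply: val_inj; rewrite /= linearP.
pose F' := GRing.isLinear.Build R P (image_mod g) *:%R f' f'L.
pose F'' : {linear P -> image_mod g} := HB.pack f' F'.
pose G' := GRing.isLinear.Build R X (image_mod g) *:%R g' g'L.
pose G'' : {linear X -> image_mod g} := HB.pack g' G'.
have [|h hE] := projP X (image_mod g) G'' F''.
  move=> y; have /asboolP[x xE] := valP y; exists x.
  by apply: val_inj; rewrite /= xE.
by exists h => p; have /(congr1 val) := hE p.
Qed.

(** * Comparison of projective resolutions *)

Section Comparison.
Variables (R : pzRingType) (M N : lmodType R).
Variables (P : proj_resolution M) (X : proj_resolution N).

Lemma pdiffK n q : pdiff P n (pdiff P n.+1 q) = 0.
Proof. by apply/pres_exact; exists q. Qed.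

Lemma paugK q : paug P (pdiff P 0 q) = 0.
Proof. by apply/pres_exact0; exists q. Qed.

(** Totalised with the zero map, so that a chain map can be built by plain recursion on the degree
    and its correctness proved afterwards. *)
Definition lift_step n (h : {linear P n -> X n}) : {linear P n.+1 -> X n.+1} :=
  if pselect (exists h' : {linear P n.+1 -> X n.+1},
      forall p, pdiff X n (h' p) = h (pdiff P n p)) is left e
  then sval (cid e) else \0.

Definition chain_map (h : forall n, {linear P n -> X n}) : Prop :=
  forall n p, pdiff X n (h n.+1 p) = h n (pdiff P n p).

Lemma chain_lift (f : {linear M -> N}) :
  exists2 h : forall n, {linear P n -> X n}, chain_map h &
    forall p, paug X (h 0%N p) = f (paug P p).
Proof.
have [|h0 h0E] := @projective_lift R (P 0%N) _ _ (paug X)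
    (f \o paug P) (@pres_projective _ _ P 0).
  by move=> p /=; have [x] := paug_surj X (f (paug P p)); exists x.
pose h := fix h n : {linear P n -> X n} :=
  if n is m.+1 then lift_step (h m) else h0.
exists h => //.
(* The default of [lift_step] is avoided as soon as [h n] sends boundaries to boundaries, which the
   induction below derives from exactness. *)
have stepP n : (forall p, exists x, pdiff X n x = h n (pdiff P n p)) ->
    forall p, pdiff X n (h n.+1 p) = h n (pdiff P n p).
  move=> ex; rewrite /= /lift_step; case: pselect => [e|[]]; first exact: (svalP (cid e)).
  exact: (@projective_lift R _ _ _ (pdiff X n) (h n \o pdiff P n)
            (@pres_projective _ _ P _)).
elim=> [|n ih]; apply: stepP => p.
  by apply/pres_exact0; rewrite h0E /= paugK raddf0.
by apply/pres_exact; rewrite ih pdiffK raddf0.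
Qed.

(** A chain map covering zero is null-homotopic, so [f] composed with it factors through the
    differential. The homotopy is never assembled: in each degree it is enough to have one component
    [s] for which [u - s d] takes values in boundaries, since the cocycle [f] kills those. *)
Lemma cocycle_coboundary_of_null (L : lmodType R)
    (u : forall n, {linear P n -> X n}) i (f : {linear X i -> L})
    (f' : {linear P i -> L}) :
  chain_map u -> (forall p, paug X (u 0%N p) = 0) -> cocycle f ->
  (forall p, f' p = f (u i p)) -> coboundary f'.
Proof.
move=> cu u0 cf f'E.
have [homot0 homot] : (forall x, exists y, pdiff X 0 y = u 0%N x) /\
  forall n, exists s : {linear P n -> X n.+1},
    forall x, exists y, pdiff X n.+1 y = u n.+1 x - s (pdiff P n x).
  have h0 x : exists y, pdiff X 0 y = u 0%N x by apply/pres_exact0.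
  split=> //; elim=> [|n [s sE]].
    have [s sE] := projective_lift (@pres_projective _ _ P 0) h0.
    exists s => x; apply/pres_exact.
    by rewrite raddfB /= sE cu subrr.
  have [t tE] := @projective_lift R (P n.+1) _ _ (pdiff X n.+1)
    (u n.+1 \- (s \o pdiff P n)) (@pres_projective _ _ P _) sE.
  exists t => x; apply/pres_exact.
  by rewrite raddfB /= tE cu /= pdiffK raddf0 subr0 subrr.
case: i f f' cf f'E => [|n] f f' cf f'E /=.
  by move=> x; rewrite f'E; have [y <-] := homot0 x; rewrite cf.
have [s sE] := homot n; exists (f \o s) => x /=.
have [y /(congr1 f)] := sE x; rewrite cf raddfB => /esym/eqP.
by rewrite subr_eq0 f'E => /eqP.
Qed.

End Comparison.

(** * Independence of Ext from the resolution *)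

Section ExtClass.
Variables (R : pzRingType) (M N : lmodType R) (i : nat) (T : Type).
Variables (act : T -> N -> N) (E : zmodType) (actE : T -> E -> E).

(* [phi] computes the i-th Ext group from [P]; [Ext_iso] says that some [P] and *)
(* [phi] do.                                                                   *)
Record ext_class (P : proj_resolution M) (phi : {linear P i -> N} -> E) :
    Prop := ExtClass {
  ext_classD : forall f g h : {linear P i -> N}, cocycle f -> cocycle g ->
    (forall x, h x = f x + g x) -> phi h = phi f + phi g;
  ext_class_act : forall t (f h : {linear P i -> N}), cocycle f ->
    (forall x, h x = act t (f x)) -> phi h = actE t (phi f);
  ext_class_surj : forall e : E,
    exists2 f : {linear P i -> N}, cocycle f & phi f = e;
  ext_class_eq0 : forall f : {linear P i -> N}, cocycle f ->
    (phi f = 0 <-> coboundary f) }.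

Lemma coboundary_comp (P P' : proj_resolution M)
    (h : forall n, {linear P n -> P' n}) j (f : {linear P' j -> N})
    (g : {linear P j -> N}) :
  chain_map h -> (forall x, g x = f (h j x)) -> coboundary f -> coboundary g.
Proof.
case: j f g => [|j] f g ch gE /=; first by move=> f0 x; rewrite gE.
by move=> [s sE]; exists (s \o h j) => x /=; rewrite gE sE ch.
Qed.

Lemma cocycle_comp (P P' : proj_resolution M)
    (h : forall n, {linear P n -> P' n}) j (f : {linear P' j -> N})
    (g : {linear P j -> N}) :
  chain_map h -> (forall x, g x = f (h j x)) -> cocycle f -> cocycle g.
Proof. by move=> ch gE cf q; rewrite gE -ch. Qed.

Lemma coboundary_cocycle (P : proj_resolution M) j (f : {linear P j -> N}) :
  coboundary f -> cocycle f.
Proof.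
case: j f => [|j] f /=; first by move=> f0 q; rewrite f0.
by move=> [s sE] q; rewrite sE pdiffK raddf0.
Qed.

Lemma coboundaryD (P : proj_resolution M) j (f g h : {linear P j -> N}) :
  (forall x, h x = f x + g x) -> coboundary f -> coboundary g -> coboundary h.
Proof.
case: j f g h => [|j] f g h hE /=.
  by move=> f0 g0 x; rewrite hE f0 g0 addr0.
by move=> [s sE] [t tE]; exists (s \+ t) => x; rewrite hE sE tE.
Qed.

Lemma ext_class_cohomologous (P : proj_resolution M) phi
    (f g h : {linear P i -> N}) :
  ext_class phi -> cocycle f -> coboundary h -> (forall x, g x = f x + h x) ->
  phi g = phi f.
Proof.
move=> ec cf bh gE.
have ch := coboundary_cocycle bh.
by rewrite (ext_classD ec cf ch gE) (proj2 (ext_class_eq0 ec ch) bh) addr0.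
Qed.

(** The identity lifts to chain maps [a] and [b] in the two directions. Their composites differ from
    the identity by chain maps covering zero, so pulling cocycles back along [b] transports [phi]
    from [P] to [P']. *)
Lemma Ext_iso_any (P' : proj_resolution M) :
  Ext_iso M N i act E actE -> exists phi, @ext_class P' phi.
Proof.
move=> [P [phi [phiD phiT phiS phi0]]].
have ec : ext_class phi by split.
have [a ca aE] := chain_lift P' P idfun.
have [b cb bE] := chain_lift P P' idfun.
have cobba (f : {linear P i -> N}) : cocycle f ->
    coboundary (f \o a i \o b i \- f).
  move=> cf; apply: (@cocycle_coboundary_of_null _ _ _ P P N
    (fun n => (a n \o b n) \- idfun) i f) => //.
  - by move=> n p /=; rewrite raddfB /= ca cb.
  - by move=> p /=; rewrite raddfB /= aE bE /= subrr.
  - by move=> p /=; rewrite raddfB.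
have cobab (f : {linear P' i -> N}) : cocycle f ->
    coboundary (f \- (f \o b i \o a i)).
  move=> cf; apply: (@cocycle_coboundary_of_null _ _ _ P' P' N
    (fun n => idfun \- (b n \o a n)) i f) => //.
  - by move=> n p /=; rewrite raddfB /= cb ca.
  - by move=> p /=; rewrite raddfB /= bE aE /= subrr.
  - by move=> p /=; rewrite raddfB.
have cocb (f : {linear P' i -> N}) : cocycle f -> cocycle (f \o b i).
  by move=> cf; exact: (cocycle_comp cb _ cf).
exists (fun f' : {linear P' i -> N} => phi (f' \o b i)); split.
- move=> f g h cf cg hE; apply: phiD => [||x /=]; [exact: cocb|exact: cocb|exact: hE].
- move=> t f h cf hE; apply: phiT => [|x /=]; [exact: cocb|exact: hE].
- move=> e; have [f cf fE] := phiS e; exists (f \o a i).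
    exact: (cocycle_comp ca _ cf).
  rewrite -fE; apply: (ext_class_cohomologous ec cf (cobba f cf)).
  by move=> x /=; rewrite addrC subrK.
- move=> f cf; split=> [/phi0|bf]; last first.
    apply/phi0; [exact: cocb|exact: (coboundary_comp cb _ bf)].
  move=> /(_ (cocb f cf)) bfb.
  have bfba : coboundary (f \o b i \o a i) by exact: (coboundary_comp ca _ bfb).
  apply: (coboundaryD _ (cobab f cf) bfba) => x //=.
  by rewrite subrK.
Qed.

End ExtClass.

(** * Splittings over a field *)

Section LinearSplitting.
Variable K : fieldType.

(* Zorn's lemma on the graphs of partial linear maps [Y -> X] that send every   *)
(* point of the image of [f] in their domain to a preimage.                     *)
Lemma linear_quasi_inverse (X Y : lmodType K) (f : {linear X -> Y}) :
  exists s : {linear Y -> X}, forall x, f (s (f x)) = f x.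
Proof.
pose lin (G : set (Y * X)) := forall c u v, G u -> G v ->
  G (c *: u.1 + v.1, c *: u.2 + v.2).
pose good (G : set (Y * X)) := [/\ lin G, forall x, G (0, x) -> x = 0
  & forall y x, G (y, x) -> (exists x', f x' = y) -> f x = y].
have [F Fgood Ftot|G [[linG G0 Gf] Gmax]] := @Zorn_bigcup _ good.
  split.
  - move=> c u v [A FA Au] [B FB Bv].
    have [/(_ _ Au) Bu|/(_ _ Bv) Av] := Ftot A B FA FB.
      by exists B => //; have [linB _ _] := Fgood B FB; apply: linB.
    by exists A => //; have [linA _ _] := Fgood A FA; apply: linA.
  - by move=> x [A /Fgood[_ A0 _]]; apply: A0.
  - by move=> y x [A /Fgood[_ _ Af]]; apply: Af.
(* A linear graph missing the origin is empty, as [u - u] would lie in it; the graph reduced to the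
   origin is then strictly larger. *)
have [G00|nG00] := pselect (G (0, 0)); last first.
  exfalso; apply: (Gmax (G `|` [set (0, 0)])%classic).
    split; first by move=> u; left.
    by move=> /(_ (0, 0)) h; apply: nG00; apply: h; right.
  have nG u : ~ G u.
    move=> Gu; apply: nG00; have := linG (-1) u u Gu Gu.
    by rewrite !scaleN1r !addNr.
  split.
  - move=> c u v [/nG //|->] [/nG //|->] /=.
    by rewrite !scaler0 !addr0; right.
  - by move=> x [/nG //|[->]].
  - by move=> y x [/nG //|[-> ->]]; rewrite raddf0.
have linG2 c u : G u -> G (c *: u.1, c *: u.2).
  by move=> Gu; have := linG c u (0, 0) Gu G00; rewrite /= !addr0.
have dom y0 : exists x, G (y0, x).
  apply: contrapT => ndom.
  (* [ext y1 x1] is [G] enlarged by the line through [(y1, x1)]. If it is good, maximality puts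
     [(y1, x1)] in [G] already. *)
  pose ext y1 x1 : set (Y * X) :=
    [set u | exists c v, G v /\ u = (v.1 + c *: y1, v.2 + c *: x1)]%classic.
  have extlin y1 x1 : lin (ext y1 x1).
    move=> c _ _ [a [u [Gu ->]]] [b [v [Gv ->]]].
    exists (c * a + b), (c *: u.1 + v.1, c *: u.2 + v.2); split; first exact: linG.
    by rewrite /= !scalerDr !scalerA !scalerDl; congr pair; rewrite addrACA.
  have extG y1 x1 : (G `<=` ext y1 x1)%classic.
    by move=> [y x] Gu; exists 0, (y, x); rewrite !scale0r !addr0.
  have max y1 x1 : good (ext y1 x1) -> G (y1, x1).
    move=> gext; apply: contrapT => nG1; apply: (Gmax _ _ gext); split=> //.
    move=> /(_ (y1, x1)) h; apply: nG1; apply: h.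
    by exists 1, (0, 0); rewrite !scale1r !add0r.
  (* If some translate [y0 + y1] of [y0] by a point of the domain lies in the image of [f], its
     preimage [x1] is the value to adjoin there. Otherwise the new domain meets the image only
     inside the old one, and the value 0 at [y0] is harmless. *)
  have [[y1 [z1 [x1 [Gyz fx1]]]]|nim] :=
      pselect (exists y1 z1 x1, G (y1, z1) /\ f x1 = y0 + y1).
    have : good (ext (y0 + y1) x1).
      split=> //.
      - move=> _ [c [[y x] [Gu [/= e ->]]]].
        have [c0|c0] := eqVneq c 0.
          by move: e; rewrite c0 !scale0r !addr0 => e; apply: G0; rewrite e.
        case: ndom; exists (- (c^-1 *: x) - z1).
        have := linG (- 1) _ _ Gyz (linG2 (- c^-1) _ Gu).
        have yE : y = - (c *: (y0 + y1)) by apply/eqP; rewrite -addr_eq0 -e.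
        rewrite /= !scaleN1r !scaleNr addrC [- z1 + _]addrC yE.
        by rewrite scalerN opprK scalerA mulVf // scale1r addrK.
      - move=> _ _ [c [[y x] [Gu [-> ->]]]] /= [x' fx'].
        rewrite linearD linearZ /= fx1 (Gf y x) //.
        exists (x' - c *: x1).
        by rewrite linearB linearZ /= fx' fx1 addrK.
    move=> /max Gx1; case: ndom; exists (- z1 + x1).
    have := linG (- 1) _ _ Gyz Gx1.
    by rewrite /= !scaleN1r [y0 + y1]addrC addKr.
  have Gy0 : good (ext y0 0).
    split=> //.
    - move=> _ [c [[y x] [Gu [/= e ->]]]].
      have [c0|c0] := eqVneq c 0.
        by move: e; rewrite c0 !scale0r !addr0 => e; apply: G0; rewrite e.
      case: ndom; exists (- (c^-1 *: x)); have := linG2 (- c^-1) _ Gu.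
      have yE : y = - (c *: y0) by apply/eqP; rewrite -addr_eq0 -e.
      by rewrite /= !scaleNr yE scalerN opprK scalerA mulVf // scale1r.
    - move=> _ _ [c [[y x] [Gu [-> ->]]]] /= [x' fx'].
      rewrite scaler0 addr0; have [c0|c0] := eqVneq c 0.
        move: fx'; rewrite c0 scale0r addr0 => fx'.
        by apply: Gf => //; exists x'.
      case: nim; exists (c^-1 *: y), (c^-1 *: x), (c^-1 *: x').
      split; first exact: linG2 Gu.
      by rewrite linearZ /= fx' scalerDr scalerA mulVf // scale1r addrC.
  by case: ndom; exists 0; apply: max.
have [s sE] := choice dom.
have uniqG y x x' : G (y, x) -> G (y, x') -> x = x'.
  move=> Gx Gx'; apply/eqP; rewrite -subr_eq0; apply/eqP; apply: G0.
  have := linG (-1) _ _ Gx' Gx.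
  by rewrite /= !scaleN1r addNr [- x' + x]addrC.
have sL : linear s.
  by move=> c u v; apply: (uniqG (c *: u + v)) => //; exact: (linG c _ _ (sE u) (sE v)).
pose s' : {linear Y -> X} := HB.pack s (GRing.isLinear.Build K Y X *:%R s sL).
exists s' => x /=.
by apply: Gf; [exact: sE | exists x].
Qed.

(** With [t] a quasi-inverse of [g], the map [idfun - t g] takes values in the kernel of [g], hence
    in the image of [f], where a quasi-inverse of [f] gives preimages. This is one stage of a
    k-linear contraction of an exact complex. *)
Lemma linear_exact_split (X Y Z : lmodType K) (f : {linear X -> Y})
    (g : {linear Y -> Z}) :
  (forall y, g y = 0 -> exists x, f x = y) ->
  exists (s : {linear Y -> X}) (t : {linear Z -> Y}),
    forall y, y = f (s y) + t (g y).
Proof.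
move=> fg; have [s sE] := linear_quasi_inverse f.
have [t tE] := linear_quasi_inverse g.
exists (s \o (idfun \- (t \o g))), t => y /=.
have [|x xE] := fg (y - t (g y)); first by rewrite raddfB /= tE subrr.
by rewrite -xE sE xE subrK.
Qed.

End LinearSplitting.

(** * Finite free resolutions *)

Section Noetherian.
Variable R : pzRingType.
Hypothesis noethR : left_noetherian R.

Definition left_submodule n (N : 'rV[R]_n -> Prop) : Prop :=
  [/\ N 0, forall x y, N x -> N y -> N (x + y) & forall r x, N x -> N (r *: x)].

(** If no finite list generates [I], adjoining again and again an element of [I] outside the current
    span gives a strictly ascending chain of left ideals. *)
Lemma left_ideal_fg (I : R -> Prop) : left_ideal I ->
  exists s : seq R, forall x,
    I x <-> exists y : 'rV[R]_(size s), x = \sum_i y 0 i * s`_i.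
Proof.
move=> [I0 ID IM]; apply: contrapT => nfg.
pose span (s : seq R) x :=
  exists y : 'rV[R]_(size s), x = \sum_i y 0 i * s`_i.
(* Coefficients indexed by [nat] keep their type when the list of generators grows. *)
pose span' (s : seq R) x :=
  exists y : nat -> R, x = \sum_(i < size s) y i * s`_i.
have spanE s x : span s x <-> span' s x.
  split=> [[y ->]|[y ->]].
    exists (fun i => oapp (y 0) 0 (insub i)); apply: eq_bigr => i _.
    by rewrite valK.
  exists (\row_i y i); by apply: eq_bigr => i _; rewrite mxE.
(* The condition on [s] sits under the existential quantifier, so that choice yields a function
   defined on all lists. *)
have next s : exists z, (forall x, x \in s -> I x) -> I z /\ ~ span' s z.
  have [sI|nsI] := pselect (forall x, x \in s -> I x); last first.
    by exists 0 => /nsI.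
  apply: contrapT => nz; apply: nfg; exists s => x; rewrite -/(span s x) spanE.
  split=> [Ix|[y ->]].
    by apply: contrapT => nx; apply: nz; exists x.
  elim/big_ind: _ => // i _; apply: IM; apply: sI; exact: mem_nth.
have [nx nxP] := choice next.
pose s := fix s n : seq R := if n is m.+1 then rcons (s m) (nx (s m)) else [::].
have sI n x : x \in s n -> I x.
  elim: n x => //= n ih x; rewrite mem_rcons inE => /orP[/eqP->|/ih //].
  by have [] := nxP _ ih.
have [||N NP] := noethR (I := fun n => span' (s n)).
- move=> n; split.
  + by exists (fun=> 0); rewrite big1 // => i _; rewrite mul0r.
  + move=> _ _ [y ->] [z ->]; exists (fun i => y i + z i).
    by rewrite -big_split; apply: eq_bigr => i _; rewrite mulrDl.
  + move=> r _ [y ->]; exists (fun i => r * y i).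
    by rewrite mulr_sumr; apply: eq_bigr => i _; rewrite mulrA.
- move=> n _ [y ->].
  (* The function [y] is arbitrary beyond the old list; the coefficient of the new generator has to
     be reset to 0. *)
  exists (fun i => if (i < size (s n))%N then y i else 0).
  rewrite /= size_rcons big_ord_recr /= ltnn mul0r addr0.
  by apply: eq_bigr => i _; rewrite ltn_ord nth_rcons ltn_ord.
have [_] := nxP _ (sI N); apply; apply: (NP N.+1) => //.
exists (fun i => if (i < size (s N))%N then 0 else 1).
rewrite /= size_rcons big_ord_recr /= ltnn mul1r nth_rcons ltnn eqxx.
by rewrite big1 ?add0r // => i _; rewrite ltn_ord mul0r.
Qed.

(** Induction on the rank. The first coordinates of [N] form a left ideal with finitely many
    generators, which lift to rows [g i] of [N]; subtracting a combination of these leaves a row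
    with first coordinate 0, covered by the induction hypothesis. *)
Lemma left_submodule_fg n (N : 'rV[R]_n -> Prop) : left_submodule N ->
  exists (l : nat) (D : 'M[R]_(l, n)), forall x, N x <-> exists y, x = y *m D.
Proof.
elim: n N => [|n ih] N [N0 ND NZ].
  exists 0%N, 0 => x; split=> [_|[y ->]]; last by rewrite mulmx0.
  by exists 0; rewrite mulmx0; apply/rowP => -[].
pose I a := exists2 x : 'rV[R]_n.+1, N x & x 0 0 = a.
have [|s sP] := @left_ideal_fg I.
  split; first by exists 0; rewrite ?mxE.
  - by move=> _ _ [x Nx <-] [y Ny <-]; exists (x + y); rewrite ?mxE //; apply: ND.
  - by move=> r _ [x Nx <-]; exists (r *: x); rewrite ?mxE //; apply: NZ.
have Is (i : 'I_(size s)) : exists x, N x /\ x 0 0 = s`_i.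
  have [|x Nx xE] := proj2 (sP s`_i); last by exists x.
  exists (delta_mx 0 i); rewrite (bigD1 i) //= !mxE !eqxx mul1r big1 ?addr0 //.
  by move=> j ji; rewrite !mxE eqxx (negbTE ji) mul0r.
have [g gP] := choice Is.
have [|l [D DP]] := ih (fun y => N (row_mx (0 : 'M_1) y : 'rV_(1 + n))).
  split; first by rewrite row_mx0.
  - move=> x y Nx Ny.
    have -> : row_mx (0 : 'M_1) (x + y) = row_mx 0 x + row_mx 0 y.
      by rewrite add_row_mx addr0.
    exact: ND.
  - move=> r x Nx.
    have -> : row_mx (0 : 'M_1) (r *: x) = r *: row_mx 0 x.
      by rewrite scale_row_mx scaler0.
    exact: NZ.
pose G : 'M[R]_(size s, 1 + n) := \matrix_(i, j) g i 0 j.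
have GE (y : 'rV_(size s)) : y *m G = \sum_i y 0 i *: g i.
  apply/rowP => j; rewrite !mxE summxE; apply: eq_bigr => i _.
  by rewrite !mxE.
have sumN (y : 'rV_(size s)) : N (y *m G).
  by rewrite GE; elim/big_ind: _ => // i _; apply: NZ; have [] := gP i.
exists (size s + l)%N, (col_mx G (row_mx (0 : 'M_(l, 1)) D)) => x; split=> [Nx|[y ->]].
  have [y yE] := proj1 (sP (x 0 0)) (ex_intro2 _ _ x Nx erefl).
  pose x' : 'rV_(1 + n) := x - y *m G.
  have Nx' : N x'.
    by apply: ND => //; rewrite -scaleN1r; apply: NZ.
  have x'0 : lsubmx x' = 0.
    apply/rowP => i; rewrite ord1 !mxE.
    have -> : lshift n (0 : 'I_1) = (0 : 'I_n.+1) by apply: val_inj.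
    rewrite yE; apply/eqP; rewrite subr_eq0; apply/eqP/eq_bigr => j _.
    by rewrite mxE; have [_ ->] := gP j.
  move: Nx'; rewrite -[x']hsubmxK x'0 => /DP[z zE].
  exists (row_mx y z); rewrite mul_row_col.
  have -> : z *m row_mx (0 : 'M_(l, 1)) D = x'.
    by rewrite mul_mx_row mulmx0 -zE -x'0 hsubmxK.
  by rewrite addrC subrK.
rewrite -[y]hsubmxK mul_row_col; apply: ND => //.
have -> : rsubmx y *m row_mx (0 : 'M_(l, 1)) D = row_mx 0 (rsubmx y *m D).
  by rewrite mul_mx_row mulmx0.
by apply/DP; exists (rsubmx y).
Qed.

End Noetherian.

(** * Complexes of finite free modules as sequences of matrices *)

Section RowModules.
Variable R : pzRingType.

Definition rmul_mx m n (D : 'M[R]_(m, n)) (x : 'rV[R]_m) : 'rV[R]_n := x *m D.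

Lemma rmul_mx_linear m n (D : 'M[R]_(m, n)) : linear (rmul_mx D).
Proof. by move=> c x y; rewrite /rmul_mx mulmxDl scalemxAl. Qed.

HB.instance Definition _ m n (D : 'M[R]_(m, n)) :=
  GRing.isLinear.Build R 'rV[R]_m 'rV[R]_n *:%R (rmul_mx D) (rmul_mx_linear D).

(** Rows are the free left module and matrices act on the right, so a linear form is a column, and
    the differential of cochains is multiplication by a matrix on the left. *)
Definition col_form n (F : 'cV[R]_n) (x : 'rV[R]_n) : R^o := (x *m F) 0 0.

Lemma col_form_linear n (F : 'cV[R]_n) : linear (col_form F).
Proof. by move=> c x y; rewrite /col_form mulmxDl -scalemxAl !mxE. Qed.

HB.instance Definition _ n (F : 'cV[R]_n) :=
  GRing.isLinear.Build R 'rV[R]_n R^o *:%R (col_form F) (col_form_linear F).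

Lemma row_sum_delta_pz n (x : 'rV[R]_n) : x = \sum_i x 0 i *: delta_mx 0 i.
Proof.
apply/rowP => j; rewrite summxE (bigD1 j) //= !mxE !eqxx mulr1 big1 ?addr0 //.
by move=> i ij; rewrite !mxE eqxx eq_sym (negbTE ij) mulr0.
Qed.

Lemma linear_row_eq n (M : lmodType R) (f g : {linear 'rV[R]_n -> M}) :
  (forall i, f (delta_mx 0 i) = g (delta_mx 0 i)) -> f =1 g.
Proof.
move=> fg x; rewrite [x]row_sum_delta_pz !linear_sum.
by apply: eq_bigr => i _; rewrite !linearZ /= fg.
Qed.

Lemma col_form_delta n (F : 'cV[R]_n) i : col_form F (delta_mx 0 i) = F i 0.
Proof.
rewrite /col_form mxE (bigD1 i) //= mxE !eqxx mul1r big1 ?addr0 // => j ji.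
by rewrite mxE eqxx (negbTE ji) mul0r.
Qed.

Lemma linear_col_form n (f : {linear 'rV[R]_n -> R^o}) :
  f =1 col_form (\col_i (f (delta_mx 0 i) : R)).
Proof. by apply: linear_row_eq => i; rewrite /= col_form_delta mxE. Qed.

Lemma col_form_inj n (F G : 'cV[R]_n) : col_form F =1 col_form G -> F = G.
Proof.
by move=> FG; apply/colP => i; have := FG (delta_mx 0 i); rewrite !col_form_delta.
Qed.

Lemma col_formM n m (D : 'M[R]_(n, m)) (F : 'cV[R]_m) x :
  col_form (D *m F) x = col_form F (x *m D).
Proof. by rewrite /col_form mulmxA. Qed.

Lemma row_projective n : projective 'rV[R]_n.
Proof.
move=> X Y g f gsurj.
have [x xE] := choice (fun i : 'I_n => gsurj (f (delta_mx 0 i))).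
pose h (y : 'rV[R]_n) : X := \sum_i y 0 i *: x i.
have hL : linear h.
  move=> c y z; rewrite /h scaler_sumr -big_split; apply: eq_bigr => i _.
  by rewrite !mxE scalerDl scalerA.
pose h' : {linear 'rV[R]_n -> X} :=
  HB.pack h (GRing.isLinear.Build R _ X *:%R h hL).
exists h' => p; rewrite {2}[p]row_sum_delta_pz !linear_sum.
by apply: eq_bigr => i _; rewrite !linearZ /= xE.
Qed.

(** The rank in degree 0 is 1 by computation, so the augmentation can be stated on ['rV_1] without
    casts. *)
Definition rank1 (r : nat -> nat) i := if i is j.+1 then r j else 1%N.

Definition exact_rows r (D : forall i, 'M[R]_(rank1 r i.+1, rank1 r i)) : Prop :=
  forall i (x : 'rV_(rank1 r i.+1)), x *m D i = 0 <-> exists y, x = y *m D i.+1.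

Section Resolution.
Variables (M : lmodType R) (r : nat -> nat).
Variables (D : forall i, 'M[R]_(rank1 r i.+1, rank1 r i)).
Variable aug : {linear 'rV[R]_1 -> M}.
Hypotheses (aug_surj : forall m, exists p, aug p = m)
  (exact0 : forall x : 'rV_1, aug x = 0 <-> exists y, x = y *m D 0)
  (exactD : exact_rows D).

Definition row_resolution : proj_resolution M.
refine (@ProjResolution R M (fun i => 'rV[R]_(rank1 r i))
  (fun i => rmul_mx (D i)) aug _ aug_surj _ _).
- by move=> i; apply: row_projective.
- by move=> x; split=> [/exact0[y ->]|[y yE]]; [exists y | apply/exact0; exists y].
- by move=> i x; split=> [/exactD[y ->]|[y yE]]; [exists y | apply/exactD; exists y].
Defined.

(** In degree 0 the incoming matrix has no columns, so that coboundaries have the same form in every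
    degree. *)
Definition prev_rank i := if i is j.+1 then rank1 r j else 0%N.

Definition prev_diff i : 'M[R]_(rank1 r i, prev_rank i) :=
  if i is j.+1 then D j else 0.

Lemma col_cocycle i (F : 'cV[R]_(rank1 r i)) :
  @cocycle _ _ R^o row_resolution i (col_form F) <-> D i *m F = 0.
Proof.
split=> [cF|DF q]; last first.
  by rewrite -[LHS]col_formM DF /col_form mulmx0 mxE.
apply: col_form_inj => x; rewrite col_formM -[LHS]/(col_form F (pdiff row_resolution i x)).
by rewrite cF /col_form mulmx0 mxE.
Qed.

Lemma col_coboundary i (F : 'cV[R]_(rank1 r i)) :
  @coboundary _ _ R^o row_resolution i (col_form F) <->
  exists G, F = prev_diff i *m G.
Proof.
case: i F => [|i] F /=; split.
- move=> F0; exists 0; rewrite mulmx0; apply: col_form_inj => x.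
  by rewrite F0 /col_form mulmx0 mxE.
- by move=> [G ->] x; rewrite mul0mx /col_form mulmx0 mxE.
- move=> [g gE]; exists (\col_i (g (delta_mx 0 i) : R)).
  apply: col_form_inj => x; rewrite col_formM gE.
  exact: (linear_col_form g).
- by move=> [G ->]; exists (col_form G) => x; rewrite col_formM.
Qed.

End Resolution.

(** Each next matrix has rows generating the left kernel of the previous one, a submodule of a
    finite free module. *)
Lemma exists_exact_rows m (D0 : 'M[R]_(m, 1)) : left_noetherian R ->
  exists (r : nat -> nat) (D : forall i, 'M[R]_(rank1 r i.+1, rank1 r i)),
    exact_rows D /\ forall x : 'rV_1, (exists y, x = y *m D0) <-> (exists y, x = y *m D 0).
Proof.
move=> noeth.
have next (s : {mn : nat * nat & 'M[R]_(mn.1, mn.2)}) :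
    exists t : {l : nat & 'M[R]_(l, (tag s).1)},
    forall x : 'rV_((tag s).1), x *m tagged s = 0 <-> exists y, x = y *m tagged t.
  have [|l [D DE]] := @left_submodule_fg R noeth _ (fun x => x *m tagged s = 0).
    split=> [|x y x0 y0|a x x0]; first by rewrite mul0mx.
      by rewrite mulmxDl x0 y0 addr0.
    by rewrite -scalemxAl x0 scaler0.
  by exists (existT (fun l => 'M[R]_(l, (tag s).1)) l D).
pose nx s := sval (cid (next s)).
have nxP s (x : 'rV_((tag s).1)) : x *m tagged s = 0 <-> exists y, x = y *m tagged (nx s).
  exact: (svalP (cid (next s))).
(* A matrix is packed with its dimensions, so that the construction iterates inside a single
   type. *)
pose step (s : {mn : nat * nat & 'M[R]_(mn.1, mn.2)}) :
    {mn : nat * nat & 'M[R]_(mn.1, mn.2)} :=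
  existT (fun mn : nat * nat => 'M[R]_(mn.1, mn.2)) (tag (nx s), (tag s).1) (tagged (nx s)).
pose st i := iter i step (existT (fun mn : nat * nat => 'M[R]_(mn.1, mn.2)) (m, 1%N) D0).
pose r i := (tag (st i)).1.
pose D i : 'M[R]_(rank1 r i.+1, rank1 r i) :=
  if i is j.+1 then tagged (nx (st j)) else D0.
exists r, D; split=> // -[|i] x; [exact: (nxP (st 0%N)) | exact: (nxP (st i.+1))].
Qed.

End RowModules.

Section CharacterResolution.
Variables (K : fieldType) (B : algType K) (e : {lrmorphism B -> K^o}).

Definition char_aug (x : 'rV[B]_1) : char_mod e := e (x 0 0).

Lemma char_aug_linear : linear char_aug.
Proof. by move=> c x y; rewrite /char_aug !mxE rmorphD rmorphM. Qed.

HB.instance Definition _ :=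
  GRing.isLinear.Build B 'rV[B]_1 (char_mod e) *:%R char_aug char_aug_linear.

Lemma char_aug_surj m : exists p, char_aug p = m.
Proof.
exists (const_mx ((m : K)%:A)); rewrite /char_aug mxE linearZ /= rmorph1.
exact: mulr1.
Qed.

Lemma exists_char_resolution : left_noetherian B ->
  exists (r : nat -> nat) (D : forall i, 'M[B]_(rank1 r i.+1, rank1 r i)),
    exact_rows D /\ forall x : 'rV_1, char_aug x = 0 <-> exists y, x = y *m D 0.
Proof.
move=> noeth.
have [|m [D0 D0E]] := @left_submodule_fg B noeth _ (fun x => char_aug x = 0).
  split=> [|x y x0 y0|a x x0]; first by rewrite raddf0.
    by rewrite linearD /= x0 y0 addr0.
  by rewrite linearZ /= x0 scaler0.
have [r [D [exD DE]]] := exists_exact_rows D0 noeth.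
by exists r, D; split=> // x; rewrite D0E.
Qed.

End CharacterResolution.

(** * Sweedler calculus *)

Section TensorCalculus.
Variable K : comNzRingType.

Lemma eq_tlift (U V W : lmodType K) (f g : U -> V -> W) t :
  (forall u v, f u v = g u v) -> tlift f t = tlift g t.
Proof. by move=> fg; apply: eq_bigr => p _. Qed.

Lemma tlift_morph (U V W : lmodType K) (W' : zmodType) (h : W -> W')
    (f : U -> V -> W) t : h 0 = 0 -> {morph h : x y / x + y} ->
  h (tlift f t) = \sum_(p <- trepr t) h (f p.1 p.2).
Proof. by move=> h0 hD; rewrite /tlift /eval_formal (big_morph h hD h0). Qed.

Lemma linear_tlift (U V W W' : lmodType K) (h : W -> W') (f : U -> V -> W) t :
  linear h -> h (tlift f t) = tlift (fun u v => h (f u v)) t.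
Proof.
move=> hL; have h0 : h 0 = 0.
  by have := hL (-1) 0 0; rewrite scaler0 addr0 scaleN1r addNr.
by apply: tlift_morph => // x y; have := hL 1 x y; rewrite !scale1r.
Qed.

Lemma mulr_tliftr (A : algType K) (U V : lmodType K) (f : U -> V -> A) a t :
  a * tlift f t = tlift (fun u v => a * f u v) t.
Proof. exact: mulr_sumr. Qed.

Lemma mulr_tliftl (A : algType K) (U V : lmodType K) (f : U -> V -> A) a t :
  tlift f t * a = tlift (fun u v => f u v * a) t.
Proof. exact: mulr_suml. Qed.

Lemma scaler_tlift (U V W : lmodType K) (f : U -> V -> W) c t :
  c *: tlift f t = tlift (fun u v => c *: f u v) t.
Proof. exact: scaler_sumr. Qed.

Lemma tlift_swap (U V X Y W : lmodType K) (F : U -> V -> X -> Y -> W) s t :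
  tlift (fun u v => tlift (F u v) t) s =
  tlift (fun x y => tlift (fun u v => F u v x y) s) t.
Proof. exact: exchange_big. Qed.

Definition is_trilinear (U V X W : lmodType K) (F : U -> V -> X -> W) : Prop :=
  (forall u, is_bilinear (F u)) /\ (forall x, is_bilinear (fun u v => F u v x)).

Section TensorRing.
Variables A B : algType K.
Implicit Types x y : tensor A B.

Lemma tensor_scaleAl c x y : (c *: x) * y = c *: (x * y).
Proof.
have := tmul_linl y c x 0; rewrite addr0 => e; apply: etrans e _.
by rewrite [X in _ + X](_ : _ = 0) ?addr0 //; exact: (@mul0r (tensor A B)).
Qed.

Lemma tensor_scaleAr c x y : x * (c *: y) = c *: (x * y).
Proof.
have := tmul_linr x c y 0; rewrite addr0 => e; apply: etrans e _.
by rewrite [X in _ + X](_ : _ = 0) ?addr0 //; exact: (@mulr0 (tensor A B)).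
Qed.

Lemma tensM (a c : A) (b d : B) : tens a b * tens c d = tens (a * c) (b * d).
Proof. exact: tmul_tens. Qed.

Lemma tensor_mulr_tliftr (U V : lmodType K) (f : U -> V -> tensor A B) x t :
  x * tlift f t = tlift (fun u v => x * f u v) t.
Proof. exact: mulr_sumr. Qed.

Lemma tensor_mulr_tliftl (U V : lmodType K) (f : U -> V -> tensor A B) x t :
  tlift f t * x = tlift (fun u v => f u v * x) t.
Proof. exact: mulr_suml. Qed.

Lemma tlift_mul (W : lmodType K) (f : A -> B -> W) x y : is_bilinear f ->
  tlift f (x * y) =
  tlift (fun c d => tlift (fun a b => f (a * c) (b * d)) x) y.
Proof.
move=> bf; rewrite [x * y]/(tmul x y) /tmul linear_tlift; last exact: tliftP.
rewrite tlift_swap; apply: eq_tlift => a b.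
rewrite linear_tlift; last exact: tliftP.
by apply: eq_tlift => c d; rewrite tlift_tens.
Qed.

End TensorRing.
End TensorCalculus.

(** * The enveloping algebra *)

Section Envelop.
Variables (K : comNzRingType) (A : algType K).

(** Both arguments are read in [A], so the opposite product shows up explicitly as a reversed
    product in the second slot. *)
Definition etens (a b : A) : envelop A := tens a (b : A^c).

Lemma etens_linl c a a' b : etens (c *: a + a') b = c *: etens a b + etens a' b.
Proof. exact: (tens_bilinear _ _).1. Qed.

Lemma etens_linr c a b b' : etens a (c *: b + b') = c *: etens a b + etens a b'.
Proof. exact: (@tens_bilinear _ A A^c).2. Qed.

Lemma etensM a b c d : etens a b * etens c d = etens (a * c) (d * b).
Proof. exact: tensM. Qed.

Lemma etens11 : etens 1 1 = 1.
Proof. by []. Qed.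

Lemma etens_bilinear : is_bilinear etens.
Proof. by split=> *; rewrite (etens_linl, etens_linr). Qed.

Lemma etensZl c a b : etens (c *: a) b = c *: etens a b.
Proof. exact: (bilinZl etens_bilinear). Qed.

Lemma etensZr c a b : etens a (c *: b) = c *: etens a b.
Proof. exact: (bilinZr etens_bilinear). Qed.

Lemma envelop_ext (W : lmodType K) (g h : envelop A -> W) : linear g -> linear h ->
  (forall a b, g (etens a b) = h (etens a b)) -> g =1 h.
Proof. by move=> gL hL gh; apply: tensor_lin_ext. Qed.

Lemma bimod_scale_etens a b m : bimod_scale (etens a b) m = a * m * b.
Proof. exact: bimod_scale_tens. Qed.

End Envelop.

Section Multilinear.
Variable K : comNzRingType.
Variables U V W : lmodType K.

Lemma bilinearI (f : U -> V -> W) :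
  (forall v, linear (f^~ v)) -> (forall u, linear (f u)) -> is_bilinear f.
Proof. by move=> fl fr; split=> c x y z; [apply: fl | apply: fr]. Qed.

Lemma linear_tlift_param (X : lmodType K) (F : X -> U -> V -> W) t :
  (forall u v, linear (fun x => F x u v)) -> linear (fun x => tlift (F x) t).
Proof.
move=> FL c x y; rewrite /tlift /eval_formal scaler_sumr -big_split.
by apply: eq_bigr => p _; apply: FL.
Qed.

Lemma linear_tlift_arg (X : lmodType K) (f : U -> V -> W)
    (g : {linear X -> tensor U V}) :
  is_bilinear f -> linear (fun x => tlift f (g x)).
Proof. by move=> bf c x y; rewrite linearP; apply: tliftP. Qed.

End Multilinear.

Lemma scale_mull (K : comNzRingType) (A : algType K) (c : K) (x y : A) :
  (c *: x) * y = c *: (x * y).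
Proof. by rewrite scalerAl. Qed.

Lemma scale_mulr (K : comNzRingType) (A : algType K) (c : K) (x y : A) :
  x * (c *: y) = c *: (x * y).
Proof. by rewrite scalerAr. Qed.

Ltac linear_normalize :=
  move=> ? ? ?; cbv beta; rewrite ?(linearP, etens_linl, etens_linr, mulrDl, mulrDr,
    scale_mull, scale_mulr, tensor_scaleAl, tensor_scaleAr) //.

(** Reduces to linearity in one variable at a time; under [tlift] the variable may occur in the
    integrand or in the tensor. *)
Ltac multilinear := cbv beta; lazymatch goal with
  | |- is_trilinear _ => split; move=> ?; multilinear
  | |- is_bilinear _ => apply: bilinearI; move=> ?; multilinear
  | |- linear (fun x => @tlift _ _ _ _ (@?f x) (@?t x)) => first
      [ apply: linear_tlift_param; move=> ? ?; multilinear
      | apply: linear_tlift_arg; multilinear ]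
  | |- linear _ => linear_normalize
  | |- _ => idtac
  end.

(** * Coassociativity and the antipode *)

Section Hopf.
Variables (K : comNzRingType) (A : algType K) (H : hopf_structure A).
Local Notation S := (antipode H).
Local Notation eps := (fun a => counit H a : K).
Local Notation D := (comul H).

(** The axiom [comulA] is an equality in a threefold tensor product; applying to it the map induced
    by [F] gives this integrated form, which justifies every regrouping of Sweedler indices
    below. *)
Lemma coassoc (W : lmodType K) (F : A -> A -> A -> W) a : is_trilinear F ->
  tlift (fun x z => tlift (fun x y => F x y z) (D x)) (D a) =
  tlift (fun x z => tlift (F x) (D z)) (D a).
Proof.
move=> [F1 F2].
have bG : is_bilinear (fun x t => tlift (F x) t).
  split=> c u v t; last exact: (tliftP (F1 u)).
  rewrite /tlift /eval_formal scaler_sumr -big_split; apply: eq_bigr => p _.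
  exact: (F2 _).1.
have /(congr1 (tlift (fun x t => tlift (F x) t))) := comulA H a.
rewrite linear_tlift; last exact: tliftP.
rewrite [RHS]linear_tlift; last exact: tliftP.
under eq_tlift => x z.
  rewrite linear_tlift; last exact: tliftP.
  under eq_tlift => x' y do rewrite tlift_tens // tlift_tens //.
over.
by under [RHS]eq_tlift => x z do rewrite tlift_tens //.
Qed.

Lemma tlift_comulM (W : lmodType K) (F : A -> A -> W) a b : is_bilinear F ->
  tlift F (D (a * b)) =
  tlift (fun u v => tlift (fun x y => F (x * u) (y * v)) (D a)) (D b).
Proof. by move=> bF; rewrite (comul_monoid H).2 tlift_mul. Qed.

Lemma tlift_comul1 (W : lmodType K) (F : A -> A -> W) : is_bilinear F ->
  tlift F (D 1) = F 1 1.
Proof. by move=> bF; rewrite (comul_monoid H).1 [1]/(tone _ _) tlift_tens. Qed.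

Lemma antipode1 : S 1 = 1.
Proof.
have := antipodel H 1; rewrite tlift_comul1 ?mulr1 ?rmorph1 ?scale1r //.
by multilinear.
Qed.

(** The sum of the [S(a_1 b_1) a_2 b_2 S(b_3) S(a_3)] is evaluated in two ways: the last four
    factors collapse to counits and leave [S(a b)], the first three collapse and leave
    [S b * S a]. *)
Lemma antipodeM a b : S (a * b) = S b * S a.
Proof.
transitivity (tlift (fun a1 a2 => tlift (fun b1 b2 =>
    (eps a2 * eps b2) *: S (a1 * b1)) (D b)) (D a)).
  rewrite -{1}(counitr H a) -{1}(counitr H b) mulr_tliftl linear_tlift; last exact: linearP.
  apply: eq_tlift => a1 a2; rewrite mulr_tliftr linear_tlift; last exact: linearP.
  apply: eq_tlift => b1 b2.
  by rewrite -scalerAl -scalerAr scalerA linearZ.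
transitivity (tlift (fun a1 a2 => tlift (fun b1 b2 =>
    tlift (fun x y => tlift (fun u v => S (a1 * b1) * x * u * S v * S y) (D b2)) (D a2))
    (D b)) (D a)).
  apply: eq_tlift => a1 a2; apply: eq_tlift => b1 b2.
  transitivity (tlift (fun x y => S (a1 * b1) * (x * (eps b2)%:A * S y)) (D a2)).
    rewrite -mulr_tliftr.
    under eq_tlift => x y do rewrite -scalerAr mulr1 -scalerAl.
    by rewrite -scaler_tlift antipoder scalerA -scalerAr mulr1 mulrC.
  apply: eq_tlift => x y; rewrite -antipoder mulr_tliftr mulr_tliftl mulr_tliftr.
  by apply: eq_tlift => u v; rewrite !mulrA.
under eq_tlift => a1 a2 do rewrite tlift_swap.
(* Regrouping brings together the first two components of [a], then those of [b], so that
   [antipodel] applies to the product [a' * b']. *)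
rewrite -(coassoc (F := fun a1 x y => tlift (fun b1 b2 =>
   tlift (fun u v => S (a1 * b1) * x * u * S v * S y) (D b2)) (D b))); last first.
  by multilinear.
under eq_tlift => a' y.
  under eq_tlift => a1 x.
    rewrite -(coassoc (F := fun b1 u v => S (a1 * b1) * x * u * S v * S y)); last first.
      by multilinear.
  over.
  rewrite tlift_swap.
  under eq_tlift => b' v.
    rewrite (_ : tlift _ _ = (eps a' * eps b') *: (S v * S y)); last first.
      rewrite tlift_swap.
      transitivity (tlift (fun x y => S x * y) (D (a' * b')) * (S v * S y)).
        rewrite tlift_comulM; last by multilinear.
        rewrite mulr_tliftl; apply: eq_tlift => b1 u.
        by rewrite mulr_tliftl; apply: eq_tlift => a1 x; rewrite !mulrA.
      by rewrite antipodel rmorphM -scalerAl mul1r.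
  over.
over.
rewrite -{2}(counitl H a) -{2}(counitl H b).
rewrite [S (tlift _ (D b))]linear_tlift; last exact: linearP.
rewrite mulr_tliftl tlift_swap; apply: eq_tlift => b' v.
rewrite linear_tlift; last exact: linearP.
rewrite mulr_tliftr; apply: eq_tlift => a' y.
by rewrite !linearZ /= -scalerAl -scalerAr scalerA mulrC.
Qed.

End Hopf.

(** * Extension along the diagonal embedding *)

Section Diagonal.
Variables (K : comNzRingType) (A : algType K) (H : hopf_structure A).
Local Notation S := (antipode H).
Local Notation eps := (fun a => counit H a : K).
Local Notation D := (comul H).

Definition diag_env (a : A) : envelop A := tlift (fun x y => etens x (S y)) (D a).

Lemma diag_env_linear : linear diag_env.
Proof. by apply: linear_tlift_arg; multilinear. Qed.

HB.instance Definition _ :=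
  GRing.isLinear.Build K A (envelop A) *:%R diag_env diag_env_linear.

Lemma diag_env_monoid : monoid_morphism diag_env.
Proof.
split=> [|a b]; rewrite /diag_env.
  by rewrite tlift_comul1 ?antipode1 //; multilinear.
rewrite tlift_comulM; last by multilinear.
rewrite tensor_mulr_tliftr; apply: eq_tlift => u v.
rewrite tensor_mulr_tliftl; apply: eq_tlift => x y.
by rewrite etensM antipodeM.
Qed.

HB.instance Definition _ :=
  GRing.isMonoidMorphism.Build A (envelop A) diag_env diag_env_monoid.

Lemma diag_envZ1 c : diag_env c%:A = c *: (1 : envelop A).
Proof. by rewrite linearZ /= rmorph1. Qed.

(** Along [diag_env] the element 1 of the bimodule [A] spans a copy of the trivial module; this
    provides the map from the induced module to [A]. *)
Lemma bimod_scale_diag a : bimod_scale (diag_env a) (1 : A) = (eps a)%:A :> A.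
Proof.
rewrite /diag_env (linear_tlift (h := fun t => bimod_scale t (1 : A) : A)); last exact: bimod_scale_lin.
rewrite -(antipoder H); apply: eq_tlift => x y.
by rewrite bimod_scale_etens mulr1.
Qed.

(** Applying [S] to the antipode axiom cancels neighbouring factors in the reversed order. *)
Lemma antipode2l a : tlift (fun x y => S (S y) * S x) (D a) = (eps a)%:A.
Proof.
have := congr1 S (antipoder H a); rewrite linear_tlift; last exact: linearP.
rewrite linearZ /= antipode1 => <-.
by apply: eq_tlift => x y; rewrite antipodeM.
Qed.

Lemma antipode2r a : tlift (fun x y => S y * S (S x)) (D a) = (eps a)%:A.
Proof.
have := congr1 S (antipodel H a); rewrite linear_tlift; last exact: linearP.
rewrite linearZ /= antipode1 => <-.
by apply: eq_tlift => x y; rewrite antipodeM.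
Qed.

Section Hat.
Variable g : {linear A -> A}.

(* Along [diag_env], [envelop A] is free as a right [A]-module on the          *)
(* [etens 1 b], and [row_ext g] is [g] extended to it coefficientwise; this     *)
(* transports k-linear splittings from [A] to [envelop A].  [col_ext] does the  *)
(* same for the left module structure.                                         *)
Definition row_ext (t : envelop A) : envelop A :=
  tlift (fun (p : A) (q : A^c) =>
    tlift (fun x y => etens 1 (y * (q : A)) * diag_env (g x)) (D p)) t.

Definition col_ext (t : envelop A) : envelop A :=
  tlift (fun (p : A) (q : A^c) =>
    tlift (fun x y => diag_env (g x) * etens 1 ((q : A) * S (S y))) (D p)) t.

Let row_bil : is_bilinear (fun (p q : A) =>
    tlift (fun x y => etens 1 (y * q) * diag_env (g x)) (D p)).
Proof. by multilinear. Qed.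

Let col_bil : is_bilinear (fun (p q : A) =>
    tlift (fun x y => diag_env (g x) * etens 1 (q * S (S y))) (D p)).
Proof. by multilinear. Qed.

Lemma row_ext_linear : linear row_ext.
Proof. exact: tliftP. Qed.

Lemma col_ext_linear : linear col_ext.
Proof. exact: tliftP. Qed.

Lemma row_ext_etens p q : row_ext (etens p q) =
  tlift (fun x y => etens 1 (y * q) * diag_env (g x)) (D p).
Proof. exact: tlift_tens. Qed.

Lemma col_ext_etens p q : col_ext (etens p q) =
  tlift (fun x y => diag_env (g x) * etens 1 (q * S (S y))) (D p).
Proof. exact: tlift_tens. Qed.

End Hat.

HB.instance Definition _ g :=
  GRing.isLinear.Build K (envelop A) (envelop A) *:%R (row_ext g) (row_ext_linear g).
HB.instance Definition _ g :=
  GRing.isLinear.Build K (envelop A) (envelop A) *:%R (col_ext g) (col_ext_linear g).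

Lemma row_ext_mulr (g h : {linear A -> A}) r t :
  (forall p, h p = g p * r) -> row_ext h t = row_ext g t * diag_env r.
Proof.
move=> hE; rewrite /row_ext tensor_mulr_tliftl; apply: eq_tlift => p q.
rewrite tensor_mulr_tliftl; apply: eq_tlift => x y.
by rewrite hE rmorphM /= mulrA.
Qed.

Lemma col_ext_mull (g h : {linear A -> A}) r t :
  (forall p, h p = r * g p) -> col_ext h t = diag_env r * col_ext g t.
Proof.
move=> hE; rewrite /col_ext tensor_mulr_tliftr; apply: eq_tlift => p q.
rewrite tensor_mulr_tliftr; apply: eq_tlift => x y.
by rewrite hE rmorphM /= mulrA.
Qed.

(** This is the expansion of [p (x) q] as the sum of the [(1 (x) p_2 q) diag_env(p_1)]: the product
    has second slot [S(p_2) p_3 q], which collapses. *)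
Lemma row_ext_id (g : {linear A -> A}) t : g =1 id -> row_ext g t = t.
Proof.
move=> gE; apply: (@envelop_ext K A _ (row_ext g) id) => [||p q] /=.
- exact: row_ext_linear.
- by [].
rewrite row_ext_etens.
transitivity (tlift (fun x z => tlift (fun u v => etens u (S v * z * q)) (D x)) (D p)).
  apply: eq_tlift => x y; rewrite gE /= tensor_mulr_tliftr; apply: eq_tlift => u v.
  by rewrite etensM mul1r mulrA.
rewrite (@coassoc _ _ H _ (fun u v z => etens u (S v * z * q))); last by multilinear.
transitivity (tlift (fun x z => etens (eps z *: x) q) (D p)).
  apply: eq_tlift => x z.
  transitivity (etens x (tlift (fun u v => S u * v) (D z) * q)).
    by rewrite mulr_tliftl linear_tlift //; multilinear.
  by rewrite antipodel -scalerAl mul1r etensZr etensZl.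
rewrite -(linear_tlift (h := fun x => etens x q)) ?counitr //; by multilinear.
Qed.

(** Here [p (x) q] is the sum of the [diag_env(p_1) (1 (x) q S^2(p_2))], because [S^2(p_3) S(p_2)]
    collapses by [antipode2l]. *)
Lemma col_ext_id (g : {linear A -> A}) t : g =1 id -> col_ext g t = t.
Proof.
move=> gE; apply: (@envelop_ext K A _ (col_ext g) id) => [||p q] /=.
- exact: col_ext_linear.
- by [].
rewrite col_ext_etens.
transitivity (tlift (fun x z => tlift (fun u v => etens u (q * S (S z) * S v)) (D x)) (D p)).
  apply: eq_tlift => x y; rewrite gE /= tensor_mulr_tliftl; apply: eq_tlift => u v.
  by rewrite etensM mulr1.
rewrite (@coassoc _ _ H _ (fun u v z => etens u (q * S (S z) * S v))); last by multilinear.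
transitivity (tlift (fun x z => etens (eps z *: x) q) (D p)).
  apply: eq_tlift => x z.
  transitivity (etens x (q * tlift (fun u v => S (S v) * S u) (D z))).
    rewrite mulr_tliftr linear_tlift; last by multilinear.
    by apply: eq_tlift => u v; rewrite mulrA.
  by rewrite antipode2l -scalerAr mulr1 etensZr etensZl.
rewrite -(linear_tlift (h := fun x => etens x q)) ?counitr //; by multilinear.
Qed.

(** Multiplying [p (x) q] by [diag_env r] produces [p_2 r_2 S(r_3) q] in the free coordinate, and
    the factors in [r_2] and [r_3] cancel, leaving only the effect of [r] on the argument of [g]. *)
Lemma row_ext_shift (g h : {linear A -> A}) r t :
  (forall p, h p = g (p * r)) -> row_ext g (t * diag_env r) = row_ext h t.
Proof.
move=> hE.
apply: (@envelop_ext K A _ (fun t => row_ext g (t * diag_env r)) (row_ext h))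
  => [||p q]; [by multilinear | exact: row_ext_linear |].
rewrite row_ext_etens /diag_env tensor_mulr_tliftr linear_tlift; last exact: row_ext_linear.
transitivity (tlift (fun x y => tlift (fun x1 x2 => tlift (fun p1 p2 =>
    etens 1 (p2 * x2 * S y * q) * diag_env (g (p1 * x1))) (D p)) (D x)) (D r)).
  apply: eq_tlift => x y; rewrite etensM row_ext_etens tlift_comulM; last by multilinear.
  by apply: eq_tlift => u v; apply: eq_tlift => p1 p2; rewrite !mulrA.
rewrite (@coassoc _ _ H _ (fun x1 x2 y => tlift (fun p1 p2 =>
  etens 1 (p2 * x2 * S y * q) * diag_env (g (p1 * x1))) (D p))); last by multilinear.
transitivity (tlift (fun x z => tlift (fun p1 p2 =>
    etens 1 (p2 * q) * diag_env (g (p1 * (eps z *: x)))) (D p)) (D r)).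
  apply: eq_tlift => x z; rewrite tlift_swap; apply: eq_tlift => p1 p2.
  transitivity (etens 1 (p2 * tlift (fun u v => u * S v) (D z) * q)
                * diag_env (g (p1 * x))).
    rewrite mulr_tliftr mulr_tliftl linear_tlift; last by multilinear.
    by rewrite tensor_mulr_tliftl; apply: eq_tlift => u v; rewrite !mulrA.
  rewrite antipoder -!scalerAr mulr1 -scalerAl etensZr !linearZ /=.
  by rewrite tensor_scaleAl tensor_scaleAr.
rewrite tlift_swap; apply: eq_tlift => p1 p2.
rewrite hE -{2}(counitr H r) mulr_tliftr.
rewrite -(linear_tlift (h := fun x => etens 1 (p2 * q) * diag_env (g x))) //.
by multilinear.
Qed.

(** The mirror cancellation is [S(r_3) S^2(r_2)], by [antipode2r]. *)
Lemma col_ext_shift (g h : {linear A -> A}) r t :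
  (forall p, h p = g (r * p)) -> col_ext g (diag_env r * t) = col_ext h t.
Proof.
move=> hE.
apply: (@envelop_ext K A _ (fun t => col_ext g (diag_env r * t)) (col_ext h))
  => [||p q]; [by multilinear | exact: col_ext_linear |].
rewrite col_ext_etens /diag_env tensor_mulr_tliftl linear_tlift; last exact: col_ext_linear.
transitivity (tlift (fun x y => tlift (fun x1 x2 => tlift (fun p1 p2 =>
    diag_env (g (x1 * p1)) * etens 1 (q * S y * S (S x2) * S (S p2))) (D p)) (D x)) (D r)).
  apply: eq_tlift => x y; rewrite etensM col_ext_etens tlift_comulM; last by multilinear.
  rewrite tlift_swap; apply: eq_tlift => u v; apply: eq_tlift => p1 p2.
  by rewrite !antipodeM !mulrA.
rewrite (@coassoc _ _ H _ (fun x1 x2 y => tlift (fun p1 p2 =>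
  diag_env (g (x1 * p1)) * etens 1 (q * S y * S (S x2) * S (S p2))) (D p)));
  last by multilinear.
transitivity (tlift (fun x z => tlift (fun p1 p2 =>
    diag_env (g ((eps z *: x) * p1)) * etens 1 (q * S (S p2))) (D p)) (D r)).
  apply: eq_tlift => x z; rewrite tlift_swap; apply: eq_tlift => p1 p2.
  transitivity (diag_env (g (x * p1)) *
      etens 1 (q * tlift (fun u v => S v * S (S u)) (D z) * S (S p2))).
    rewrite mulr_tliftr mulr_tliftl linear_tlift; last by multilinear.
    by rewrite tensor_mulr_tliftr; apply: eq_tlift => u v; rewrite !mulrA.
  rewrite antipode2r -!scalerAl -scalerAr mulr1 -scalerAl etensZr !linearZ /=.
  by rewrite tensor_scaleAl tensor_scaleAr.
rewrite tlift_swap; apply: eq_tlift => p1 p2.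
rewrite hE -{2}(counitr H r) mulr_tliftl.
rewrite -(linear_tlift (h := fun x => diag_env (g x) * etens 1 (q * S (S p2)))) //.
by multilinear.
Qed.

(** Applying the counit to the [A]-coordinate of [p (x) q] leaves [1 (x) p q]: the augmentation of
    the trivial module extends to the multiplication map onto the bimodule [A]. *)
Lemma row_ext_counit (g : {linear A -> A}) r t :
  (forall p, g p = (eps p)%:A * r) ->
  row_ext g t = etens 1 (bimod_scale t (1 : A)) * diag_env r.
Proof.
move=> gE.
apply: (@envelop_ext K A _ (row_ext g)
  (fun t => etens 1 (bimod_scale t (1 : A)) * diag_env r)) => [||p q].
- exact: row_ext_linear.
- by move=> c x y; rewrite bimod_scale_lin etens_linr mulrDl tensor_scaleAl.
rewrite row_ext_etens bimod_scale_etens mulr1.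
rewrite -{2}(counitl H p) mulr_tliftl linear_tlift; last by multilinear.
rewrite tensor_mulr_tliftl; apply: eq_tlift => x y.
rewrite gE -!scalerAl mul1r etensZr linearZ /=.
by rewrite tensor_scaleAl tensor_scaleAr.
Qed.

Lemma col_ext_scalar (g : {linear A -> A}) (l : A -> K) t :
  (forall p, g p = (l p)%:A) -> exists v, col_ext g t = etens 1 v.
Proof.
move=> gE; exists (tlift (fun (p : A) (q : A^c) =>
  tlift (fun x y => l x *: ((q : A) * S (S y))) (D p)) t).
rewrite linear_tlift; last by multilinear.
apply: eq_tlift => p q; rewrite linear_tlift; last by multilinear.
apply: eq_tlift => x y.
by rewrite gE diag_envZ1 tensor_scaleAl mul1r etensZr.
Qed.

End Diagonal.

Definition linear_of (R : pzRingType) (U V : lmodType R) (f : U -> V)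
    (fL : linear f) : {linear U -> V} :=
  HB.pack f (GRing.isLinear.Build R U V *:%R f fL).

(** * Transport of k-linear maps between spaces of matrices *)

Section ScalarMatrices.
Variables (K : comNzRingType) (A : algType K).

(** Matrices over [A] as a k-space: the splittings to be transported are only k-linear. *)
Definition kmx m n : lmodType K := restrict (in_alg A) 'M[A]_(m, n).

Lemma kmxZE m n c (x : 'M[A]_(m, n)) :
  (c *: (x : kmx m n) : 'M[A]_(m, n)) = map_mx ( *:%R c) x.
Proof. by apply/matrixP => i j; rewrite restrictZE !mxE /= mulr_algl. Qed.

Definition entry_map m n m' n' (s : {linear kmx m n -> kmx m' n'}) i j i' j'
  (p : A) : A := (s (p *: delta_mx i j : 'M_(m, n)) : 'M_(m', n')) i' j'.

Lemma entry_map_linear m n m' n' (s : {linear kmx m n -> kmx m' n'}) i j i' j' :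
  linear (entry_map s i j i' j').
Proof.
move=> c x y; rewrite /entry_map.
have -> : ((c *: x + y) *: delta_mx i j : 'M[A]_(m, n)) =
    (c *: (x *: delta_mx i j : kmx m n) + (y *: delta_mx i j : kmx m n)).
  by rewrite scalerDl restrictZE scalerA /= mulr_algl.
by rewrite linearP [LHS]mxE kmxZE mxE.
Qed.

HB.instance Definition _ m n m' n' (s : {linear kmx m n -> kmx m' n'}) i j i' j' :=
  GRing.isLinear.Build K A A *:%R (entry_map s i j i' j')
    (entry_map_linear s i j i' j').

End ScalarMatrices.
Arguments kmx {K} A m n.

Section MatrixExtension.
Variables (K : comNzRingType) (A : algType K) (H : hopf_structure A).
Local Notation dl := (map_mx (diag_env H)).

Lemma row_ext_sum (I : finType) (g : {linear A -> A}) (h : I -> {linear A -> A}) t :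
  (forall p, g p = \sum_i h i p) -> row_ext H g t = \sum_i row_ext H (h i) t.
Proof.
move=> gE; apply: (@envelop_ext K A _ (row_ext H g)
  (fun t => \sum_i row_ext H (h i) t)) => [||p q].
- exact: row_ext_linear.
- move=> c x y; rewrite scaler_sumr -big_split; apply: eq_bigr => i _.
  exact: row_ext_linear.
rewrite row_ext_etens; under [RHS]eq_bigr do rewrite row_ext_etens.
rewrite /tlift /eval_formal exchange_big; apply: eq_bigr => u _ /=.
by rewrite gE linear_sum mulr_sumr.
Qed.

Lemma col_ext_sum (I : finType) (g : {linear A -> A}) (h : I -> {linear A -> A}) t :
  (forall p, g p = \sum_i h i p) -> col_ext H g t = \sum_i col_ext H (h i) t.
Proof.
move=> gE; apply: (@envelop_ext K A _ (col_ext H g)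
  (fun t => \sum_i col_ext H (h i) t)) => [||p q].
- exact: col_ext_linear.
- move=> c x y; rewrite scaler_sumr -big_split; apply: eq_bigr => i _.
  exact: col_ext_linear.
rewrite col_ext_etens; under [RHS]eq_bigr do rewrite col_ext_etens.
rewrite /tlift /eval_formal exchange_big; apply: eq_bigr => u _ /=.
by rewrite gE linear_sum mulr_suml.
Qed.

Lemma mulr_linear_r (g : {linear A -> A}) r : linear (fun p => g p * r).
Proof. by multilinear. Qed.

Lemma mulr_linear_l (g : {linear A -> A}) r : linear (fun p => r * g p).
Proof. by multilinear. Qed.

Lemma linear_mulr_r (g : {linear A -> A}) r : linear (fun p => g (p * r)).
Proof. by multilinear. Qed.

Lemma linear_mulr_l (g : {linear A -> A}) r : linear (fun p => g (r * p)).
Proof. by multilinear. Qed.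

(** [row_ext] applied to each component of [s]. The lemmas below show that identities between
    k-linear maps built from sums and from composition with matrices over [A] carry over to
    [envelop A]. *)
Definition row_mx_ext m l (s : {linear kmx A 1 m -> kmx A 1 l})
    (Y : 'rV[envelop A]_m) : 'rV[envelop A]_l :=
  \row_j \sum_i row_ext H (entry_map s 0 i 0 j) (Y 0 i).

Definition col_mx_ext m l (s : {linear kmx A m 1 -> kmx A l 1})
    (Y : 'cV[envelop A]_m) : 'cV[envelop A]_l :=
  \col_j \sum_i col_ext H (entry_map s i 0 j 0) (Y i 0).

Lemma row_mx_ext0 m l (s : {linear kmx A 1 m -> kmx A 1 l}) : row_mx_ext s 0 = 0.
Proof. by apply/rowP => j; rewrite !mxE big1 // => i _; rewrite mxE linear0. Qed.

Lemma col_mx_ext0 m l (s : {linear kmx A m 1 -> kmx A l 1}) : col_mx_ext s 0 = 0.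
Proof. by apply/colP => j; rewrite !mxE big1 // => i _; rewrite mxE linear0. Qed.

Lemma row_ext_eq0 (g : {linear A -> A}) t : (forall p, g p = 0) -> row_ext H g t = 0.
Proof.
move=> g0; have := @row_ext_sum 'I_0 g (fun=> g) t.
by rewrite big_ord0; apply=> p; rewrite big_ord0.
Qed.

Lemma col_ext_eq0 (g : {linear A -> A}) t : (forall p, g p = 0) -> col_ext H g t = 0.
Proof.
move=> g0; have := @col_ext_sum 'I_0 g (fun=> g) t.
by rewrite big_ord0; apply=> p; rewrite big_ord0.
Qed.

Lemma row_mx_ext_id m (s : {linear kmx A 1 m -> kmx A 1 m}) Y :
  s =1 id -> row_mx_ext s Y = Y.
Proof.
move=> sE; apply/rowP => j; rewrite mxE (bigD1 j) //= row_ext_id; last first.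
  by move=> p; rewrite /= /entry_map sE !mxE !eqxx mulr1.
rewrite big1 ?addr0 // => i ij; rewrite row_ext_eq0 // => p.
by rewrite /= /entry_map sE !mxE eqxx eq_sym (negbTE ij) mulr0.
Qed.

Lemma col_mx_ext_id m (s : {linear kmx A m 1 -> kmx A m 1}) Y :
  s =1 id -> col_mx_ext s Y = Y.
Proof.
move=> sE; apply/colP => j; rewrite mxE (bigD1 j) //= col_ext_id; last first.
  by move=> p; rewrite /= /entry_map sE !mxE !eqxx mulr1.
rewrite big1 ?addr0 // => i ij; rewrite col_ext_eq0 // => p.
by rewrite /= /entry_map sE !mxE eqxx eq_sym (negbTE ij) mulr0.
Qed.

Lemma row_mx_extD m l (s s1 s2 : {linear kmx A 1 m -> kmx A 1 l}) Y :
  (forall y, s y = s1 y + s2 y) ->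
  row_mx_ext s Y = row_mx_ext s1 Y + row_mx_ext s2 Y.
Proof.
move=> sE; apply/rowP => j; rewrite !mxE -big_split; apply: eq_bigr => i _ /=.
rewrite (@row_ext_sum bool _ (fun b : bool => if b then (entry_map s1 0 i 0 j : {linear A -> A})
    else (entry_map s2 0 i 0 j : {linear A -> A}))).
  by rewrite big_bool.
by move=> p; rewrite big_bool /= /entry_map sE [LHS]mxE.
Qed.

Lemma col_mx_extD m l (s s1 s2 : {linear kmx A m 1 -> kmx A l 1}) Y :
  (forall y, s y = s1 y + s2 y) ->
  col_mx_ext s Y = col_mx_ext s1 Y + col_mx_ext s2 Y.
Proof.
move=> sE; apply/colP => j; rewrite !mxE -big_split; apply: eq_bigr => i _ /=.
rewrite (@col_ext_sum bool _ (fun b : bool => if b then (entry_map s1 i 0 j 0 : {linear A -> A})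
    else (entry_map s2 i 0 j 0 : {linear A -> A}))).
  by rewrite big_bool.
by move=> p; rewrite big_bool /= /entry_map sE [LHS]mxE.
Qed.

Lemma row_mx_ext_mulr m l n (s : {linear kmx A 1 m -> kmx A 1 l})
    (h : {linear kmx A 1 m -> kmx A 1 n}) (D : 'M[A]_(l, n)) Y :
  (forall y, h y = (s y : 'rV_l) *m D) ->
  row_mx_ext h Y = row_mx_ext s Y *m dl D.
Proof.
move=> hE; apply/rowP => j; rewrite !mxE.
under [RHS]eq_bigr => u _ do rewrite !mxE mulr_suml.
rewrite exchange_big; apply: eq_bigr => i _ /=.
rewrite (@row_ext_sum _ _ (fun u => linear_of
    (mulr_linear_r (entry_map s 0 i 0 u) (D u j)))); last first.
  by move=> p; rewrite /= /entry_map hE mxE.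
by apply: eq_bigr => u _; apply: row_ext_mulr.
Qed.

Lemma col_mx_ext_mull m l n (s : {linear kmx A m 1 -> kmx A l 1})
    (h : {linear kmx A m 1 -> kmx A n 1}) (D : 'M[A]_(n, l)) Y :
  (forall y, h y = D *m (s y : 'cV_l)) ->
  col_mx_ext h Y = dl D *m col_mx_ext s Y.
Proof.
move=> hE; apply/colP => j; rewrite !mxE.
under [RHS]eq_bigr => u _ do rewrite !mxE mulr_sumr.
rewrite exchange_big; apply: eq_bigr => i _ /=.
rewrite (@col_ext_sum _ _ (fun u => linear_of
    (mulr_linear_l (entry_map s i 0 u 0) (D j u)))); last first.
  by move=> p; rewrite /= /entry_map hE mxE.
by apply: eq_bigr => u _; apply: col_ext_mull.
Qed.

Lemma row_mx_ext_shift m l n (s : {linear kmx A 1 n -> kmx A 1 l})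
    (h : {linear kmx A 1 m -> kmx A 1 l}) (D : 'M[A]_(m, n)) Y :
  (forall y : 'rV_m, h y = s (y *m D)) ->
  row_mx_ext h Y = row_mx_ext s (Y *m dl D).
Proof.
move=> hE; apply/rowP => j; rewrite !mxE.
under [RHS]eq_bigr => u _ do rewrite !mxE linear_sum.
rewrite exchange_big; apply: eq_bigr => i _ /=.
rewrite (@row_ext_sum _ _ (fun u => linear_of
    (linear_mulr_r (entry_map s 0 u 0 j) (D i u)))); last first.
  move=> p; rewrite /= /entry_map hE.
  have -> : (p *: delta_mx 0 i *m D : 'rV_n) =
      \sum_u ((p * D i u) *: delta_mx 0 u : kmx A 1 n).
    rewrite -scalemxAl -rowE [LHS]row_sum_delta_pz.
    by apply: eq_bigr => u _; rewrite !mxE.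
  by rewrite linear_sum summxE.
by apply: eq_bigr => u _; rewrite mxE; symmetry; apply: row_ext_shift.
Qed.

Lemma col_mx_ext_shift m l n (s : {linear kmx A n 1 -> kmx A l 1})
    (h : {linear kmx A m 1 -> kmx A l 1}) (D : 'M[A]_(n, m)) Y :
  (forall y : 'cV_m, h y = s (D *m y)) ->
  col_mx_ext h Y = col_mx_ext s (dl D *m Y).
Proof.
move=> hE; apply/colP => j; rewrite !mxE.
under [RHS]eq_bigr => u _ do rewrite !mxE linear_sum.
rewrite exchange_big; apply: eq_bigr => i _ /=.
rewrite (@col_ext_sum _ _ (fun u => linear_of
    (linear_mulr_l (entry_map s u 0 j 0) (D u i)))); last first.
  move=> p; rewrite /= /entry_map hE.
  have -> : (D *m (p *: delta_mx i 0) : 'cV_n) =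
      \sum_u ((D u i * p) *: delta_mx u 0 : kmx A n 1).
    apply/colP => w; rewrite summxE mxE (bigD1 i) //= !mxE !eqxx mulr1 big1 ?addr0.
      rewrite (bigD1 w) //= !mxE !eqxx mulr1 big1 ?addr0 // => u uw.
      by rewrite !mxE eq_sym (negbTE uw) mulr0.
    by move=> u ui; rewrite !mxE (negbTE ui) !mulr0.
  by rewrite linear_sum summxE.
by apply: eq_bigr => u _; rewrite mxE; symmetry; apply: col_ext_shift.
Qed.

Lemma row_mx_ext_counit l (h : {linear kmx A 1 1 -> kmx A 1 l}) (r : 'rV[A]_l) Y :
  (forall y : 'rV_1, h y = (counit H (y 0 0) : K)%:A *: r) ->
  row_mx_ext h Y = etens 1 (bimod_scale (Y 0 0) (1 : A)) *: dl r.
Proof.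
move=> hE; apply/rowP => j; rewrite !mxE big_ord1.
apply: row_ext_counit => p.
by rewrite /= /entry_map hE !mxE !eqxx mulr1.
Qed.

(** A k-linear form [lam] extends to a map with values in the elements [1 (x) v]; this is how a
    coefficient [v] in [A] is extracted from a class over [envelop A]. *)
Lemma col_mx_ext_scalar m l (h : {linear kmx A m 1 -> kmx A l 1})
    (lam : kmx A m 1 -> K) (F : 'cV[A]_l) Y : linear (lam : _ -> K^o) ->
  (forall y, h y = F *m ((lam y)%:A)%:M) ->
  exists v, col_mx_ext h Y = dl F *m (etens 1 v)%:M.
Proof.
move=> lamL hE.
have gL i : linear (fun p : A => (lam (p *: delta_mx i 0 : 'cV_m))%:A : A).
  move=> c x y.
  have -> : ((c *: x + y) *: delta_mx i 0 : 'cV[A]_m) =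
      (c *: (x *: delta_mx i 0 : kmx A m 1) + (y *: delta_mx i 0 : kmx A m 1)).
    by rewrite scalerDl restrictZE scalerA /= mulr_algl.
  by rewrite lamL scalerDl scalerA.
have vP i := @col_ext_scalar _ _ H (linear_of (gL i)) _ (Y i 0) (fun=> erefl).
have [v vE] := choice vP.
exists (\sum_i v i); apply/colP => j; rewrite !mxE big_ord1 !mxE eqxx.
have -> : etens 1 (\sum_i v i) = \sum_i etens 1 (v i) :> envelop A.
  pose f := linear_of (fun c x y => etens_linr c (1 : A) x y).
  exact: (linear_sum f).
rewrite mulr_sumr; apply: eq_bigr => i _; rewrite -vE.
by apply: col_ext_mull => p; rewrite /= /entry_map hE mxE big_ord1 !mxE eqxx.
Qed.

End MatrixExtension.

(** The left annihilators of the powers of [c] stabilise. With [x = c v - 1], the element [x v^N]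
    kills [c^(N+1)], hence [c^N], and [x v^N c^N = x]. *)
Lemma noetherian_mulr_eq1 (R : pzRingType) (v c : R) :
  left_noetherian R -> v * c = 1 -> c * v = 1.
Proof.
move=> noeth vc.
have [||N NP] := noeth (fun n x => x * c ^+ n = 0).
- move=> n; split; first exact: mul0r.
  + by move=> x y x0 y0; rewrite mulrDl x0 y0 addr0.
  + by move=> r x x0; rewrite -mulrA x0 mulr0.
- by move=> n x x0; rewrite exprSr mulrA x0 mul0r.
have vcN n : v ^+ n * c ^+ n = 1.
  elim: n => [|n ih]; first by rewrite mulr1.
  by rewrite exprSr exprS mulrA -[v ^+ n * v * c]mulrA vc mulr1.
apply/eqP; rewrite -subr_eq0; apply/eqP; set x := c * v - 1.
have xc : x * c = 0 by rewrite mulrBl -mulrA vc mulr1 mul1r subrr.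
have e : x * v ^+ N * c ^+ N.+1 = 0.
  by rewrite exprSr mulrA -[x * _ * _]mulrA vcN mulr1.
by have := NP N.+1 _ (leqnSn N) e; rewrite -mulrA vcN mulr1.
Qed.

Section KLinear.
Variables (K : comNzRingType) (A : algType K).

Lemma kmx_mulr_linear m n p (D : 'M[A]_(n, p)) :
  linear ((fun y : 'M[A]_(m, n) => y *m D) : kmx A m n -> kmx A m p).
Proof. by move=> c x y; rewrite !restrictZE [LHS]mulmxDl -scalemxAl. Qed.

Lemma kmx_mull_linear m n p (D : 'M[A]_(m, n)) :
  linear ((fun y : 'M[A]_(n, p) => D *m y) : kmx A n p -> kmx A m p).
Proof.
move=> c x y; rewrite [LHS]mulmxDr !restrictZE; congr (_ + _ : 'M_(_, _)).
apply/matrixP => i j; rewrite !mxE mulr_sumr; apply: eq_bigr => u _.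
by rewrite !mxE /= !mulr_algl scalerAr.
Qed.

Definition kmx_mulr m n p (D : 'M[A]_(n, p)) : {linear kmx A m n -> kmx A m p} :=
  linear_of (@kmx_mulr_linear m n p D).
Definition kmx_mull m n p (D : 'M[A]_(m, n)) : {linear kmx A n p -> kmx A m p} :=
  linear_of (@kmx_mull_linear m n p D).

End KLinear.

(** Pointwise equal linear maps may be packed differently; they differ by the zero coboundary, so
    [phi] does not separate them. *)
Lemma ext_class_eq (R : pzRingType) (M N : lmodType R) i T
    (act : T -> N -> N) (E : zmodType) (actE : T -> E -> E)
    (P : proj_resolution M) (phi : {linear P i -> N} -> E)
    (f g : {linear P i -> N}) :
  ext_class act actE phi -> cocycle f -> f =1 g -> phi g = phi f.
Proof.
move=> ec cf fg; apply: (ext_class_cohomologous (h := \0) ec cf).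
  by case: (i) => [|j] /=; [|exists \0].
by move=> x; rewrite addr0 fg.
Qed.

(** * The bimodule resolution induced from the trivial module *)

Section EnvelopResolution.
Variables (K : fieldType) (A : algType K) (H : hopf_structure A).
Variables (r : nat -> nat) (D : forall i, 'M[A]_(rank1 r i.+1, rank1 r i)).
Hypotheses (exD : exact_rows D)
  (ex0 : forall x : 'rV_1, char_aug (counit H) x = 0 <-> exists y, x = y *m D 0).
Local Notation dl := (map_mx (diag_env H)).
Local Notation eps := (fun a => counit H a : K).

Definition env_aug (x : 'rV[envelop A]_1) : bimod A := x 0 0 *: (1 : bimod A).

Lemma env_aug_linear : linear env_aug.
Proof. by move=> c x y; rewrite /env_aug !mxE scalerDl scalerA. Qed.

Lemma env_aug_surj m : exists p, linear_of env_aug_linear p = m.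
Proof.
exists (const_mx (etens m 1)); rewrite /= /env_aug mxE.
by apply: etrans (bimod_scale_etens _ _ _) _; rewrite !mulr1.
Qed.

(** A k-linear contraction of the complex over [A] extends through [row_mx_ext]. On a cycle [Y] the
    summand factoring through [D i] vanishes, and the other one exhibits [Y] as a boundary. *)
Lemma env_exact : exact_rows (fun i => dl (D i)).
Proof.
move=> i Y; split=> [Y0|[Z ->]]; last first.
  rewrite -mulmxA -map_mxM (_ : D i.+1 *m D i = 0) ?map_mx0 ?mulmx0 //.
  apply/row_matrixP => u; rewrite row_mul row0; apply/exD.
  by exists (delta_mx 0 u); rewrite -rowE.
have [|s [t st]] := @linear_exact_split K _ _ _
    (kmx_mulr 1 (D i.+1)) (kmx_mulr 1 (D i)).
  by move=> y /exD[x ->]; exists x.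
exists (row_mx_ext H s Y).
rewrite -{1}[Y](@row_mx_ext_id _ _ H _ idfun) //.
rewrite (@row_mx_extD _ _ H _ _ _ (kmx_mulr 1 (D i.+1) \o s)
           (t \o kmx_mulr 1 (D i))) //.
rewrite (@row_mx_ext_mulr _ _ H _ _ _ s _ (D i.+1)) //.
by rewrite (@row_mx_ext_shift _ _ H _ _ _ t _ (D i)) // Y0 row_mx_ext0 addr0.
Qed.

Lemma env_exact0 (Y : 'rV_1) :
  linear_of env_aug_linear Y = 0 <-> exists Z, Y = Z *m dl (D 0).
Proof.
split=> [Y0|[Z ->]]; last first.
  rewrite /= /env_aug mxE scaler_suml big1 // => u _.
  rewrite mxE -scalerA.
  rewrite [X in _ *: X](_ : _ = 0) ?scaler0 //.
  apply: etrans (bimod_scale_diag H _) _.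
  have /ex0 : exists y, row u (D 0) = y *m D 0 by exists (delta_mx 0 u); rewrite rowE.
  by rewrite /char_aug mxE => ->; rewrite scale0r.
have epsL : linear ((fun y : 'rV[A]_1 => counit H (y 0 0)) : kmx A 1 1 -> K^o).
  move=> c x y; rewrite restrictZE !mxE rmorphD rmorphM; congr (_ + _).
  by rewrite /= linearZ /= rmorph1; congr (_ * _); exact: mulr1.
have [|s [t st]] := @linear_exact_split K _ _ _
    (kmx_mulr 1 (D 0)) (linear_of epsL).
  by move=> y /ex0[x ->]; exists x.
exists (row_mx_ext H s Y).
rewrite -{1}[Y](@row_mx_ext_id _ _ H _ idfun) //.
rewrite (@row_mx_extD _ _ H _ _ _ (kmx_mulr 1 (D 0) \o s)
           (t \o linear_of epsL)) //.
rewrite (@row_mx_ext_mulr _ _ H _ _ _ s _ (D 0)) //.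
(* The summand through the counit becomes a multiple of the augmentation of [Y], which is 0. *)
rewrite (@row_mx_ext_counit _ _ H _ _ (t 1)); last first.
  move=> y /=; rewrite -[X in t X]mulr1.
  by rewrite -[X in t X]/(eps (y 0 0) *: (1 : K^o)) linearZ.
rewrite -[bimod_scale _ _]/(linear_of env_aug_linear Y) Y0.
by rewrite (_ : etens 1 0 = 0) ?scale0r ?addr0 //; apply: (bilin0r (etens_bilinear A)).
Qed.

Definition env_resolution : proj_resolution (bimod A) :=
  row_resolution env_aug_surj env_exact0 env_exact.

End EnvelopResolution.

(** * The Nakayama automorphism as a winding automorphism *)

Lemma map_prev_diff (R S : pzRingType) (f : {rmorphism R -> S}) r
    (D : forall i, 'M[R]_(rank1 r i.+1, rank1 r i)) i :
  map_mx f (prev_diff D i) = prev_diff (fun i => map_mx f (D i)) i.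
Proof. by case: i => [|i] //=; rewrite map_mx0. Qed.

Lemma col_form_scalar (R : pzRingType) n (F : 'cV[R]_n) (a : R) x :
  col_form (F *m a%:M) x = col_form F x * a.
Proof. by rewrite /col_form mulmxA mxE big_ord1 [in a%:M _ _]mxE eqxx mulr1n. Qed.

Lemma col_formD (R : pzRingType) n (F G : 'cV[R]_n) x :
  col_form (F + G) x = col_form F x + col_form G x.
Proof. by rewrite /col_form mulmxDr mxE. Qed.

Lemma kmx_scalar_linear (K : comNzRingType) (A : algType K) n (F : 'cV[A]_n) :
  linear ((fun z : K^o => F *m ((z : K)%:A)%:M) : K^o -> kmx A n 1).
Proof.
move=> c x y; apply/matrixP => i j; rewrite ord1.
rewrite [RHS]mxE kmxZE !mxE !big_ord1 !mxE eqxx !mulr1n.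
by rewrite scalerDl mulrDr -scalerA scalerAr.
Qed.

Section Winding.
Variables (K : fieldType) (A : algType K) (H : hopf_structure A) (d : nat).
Variables (pi0 : {lrmorphism A -> K^o}) (nu : {lrmorphism A -> A}).
Hypothesis noeth : left_noetherian A.
Hypothesis int_pi0 : integral_character (counit H) d pi0.
Hypothesis nak_nu : nakayama_automorphism d nu.
Local Notation S := (antipode H).
Local Notation D := (comul H).
Local Notation dl := (map_mx (diag_env H)).

(* [c] is the class of [diag_env f0], with [f0] a generating cocycle for the    *)
(* trivial module, and [v] writes the class [1] as a multiple of [c].           *)
Lemma nakayama_integral_relation : exists c v : A, v * c = 1 /\
  forall a, tlift (fun x y => S y * c * nu x) (D a) = (pi0 a : K) *: c.
Proof.
have [r [Df [exD ex0]]] := exists_char_resolution (counit H) noeth.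
pose P := row_resolution (@char_aug_surj _ _ (counit H)) ex0 exD.
pose J := env_resolution exD ex0.
have [phi ecP] := Ext_iso_any P int_pi0.
have [_ _ /(Ext_iso_any J)[psi ecJ]] := nak_nu.
pose cP (F : 'cV[A]_(rank1 r d)) : {linear P d -> A^o} := col_form F.
pose cJ (F : 'cV[envelop A]_(rank1 r d)) : {linear J d -> (envelop A)^o} := col_form F.
have cocP F : cocycle (cP F) <-> Df d *m F = 0 by exact: col_cocycle.
have cobP F : coboundary (cP F) <-> exists G, F = prev_diff Df d *m G.
  exact: col_coboundary.
have cocJ F : cocycle (cJ F) <-> dl (Df d) *m F = 0 by exact: col_cocycle.
have cobJ F : coboundary (cJ F) <-> exists G, F = dl (prev_diff Df d) *m G.
  by rewrite map_prev_diff; exact: col_coboundary.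
(* A generating cocycle for the trivial module; [F0] is its column. *)
have [f0 cf0 f0E] := ext_class_surj ecP 1.
pose F0 : 'cV[A]_(rank1 r d) := \col_i (f0 (delta_mx 0 i) : A).
have f0F : f0 =1 cP F0 by exact: (linear_col_form f0).
have cF0 : cocycle (cP F0) by move=> q; rewrite -f0F cf0.
have F0E : phi (cP F0) = 1 by rewrite -f0E; apply: ext_class_eq ecP cf0 f0F.
have DF0 : Df d *m F0 = 0 by apply/cocP.
have F0act a : phi (cP (F0 *m a%:M)) = pi0 a.
  rewrite (ext_class_act ecP (t := a) (f := cP F0)) // ?F0E ?mul1r //.
  by move=> x; exact: col_form_scalar.
(* Since Ext is one-dimensional, every cocycle is a scalar multiple of [F0] up to a coboundary. *)
have cohomP y : Df d *m y = 0 ->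
    exists G, y = F0 *m ((phi (cP y) : K)%:A)%:M + prev_diff Df d *m G.
  move=> Dy; pose c : K := phi (cP y).
  have Dc a : Df d *m (F0 *m a%:M) = 0 by rewrite mulmxA DF0 mul0mx.
  have /cobP[G GE] : coboundary (cP (y - F0 *m (c%:A)%:M)).
    have cz : cocycle (cP (y - F0 *m (c%:A)%:M)).
      by apply/cocP; rewrite mulmxBr Dy Dc subrr.
    apply/(ext_class_eq0 ecP cz).
    have := @ext_classD _ _ _ _ _ _ _ _ _ _ ecP (cP (y - F0 *m (c%:A)%:M))
      (cP (F0 *m (c%:A)%:M)) (cP y) cz (proj2 (cocP _) (Dc _)).
    rewrite F0act => /(_ _)/esym e; apply: (addIr (pi0 c%:A)); rewrite add0r e.
      by rewrite linearZ /= rmorph1; exact: esym (mulr1 _).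
    by move=> x; rewrite /= -col_formD subrK.
  by exists G; rewrite -GE addrC subrK.
have cdlF0 t : cocycle (cJ (dl F0 *m t%:M)).
  by apply/cocJ; rewrite mulmxA -map_mxM DF0 map_mx0 mul0mx.
pose c := psi (cJ (dl F0 *m 1%:M)).
have psi_etens a b : psi (cJ (dl F0 *m (etens a b)%:M)) = b * c * nu a.
  apply: (ext_class_act ecJ (t := (b, a)) (f := cJ (dl F0 *m 1%:M))) => // x.
  by rewrite [LHS]col_form_scalar [in RHS]/= col_form_scalar mulr1.
have psi0 : psi (cJ (dl F0 *m 0%:M)) = 0.
  apply/(ext_class_eq0 ecJ (cdlF0 0))/cobJ.
  by exists 0; rewrite mulmx0 raddf0 mulmx0.
have psiD s t : psi (cJ (dl F0 *m (s + t)%:M)) =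
    psi (cJ (dl F0 *m s%:M)) + psi (cJ (dl F0 *m t%:M)).
  apply: (ext_classD ecJ) => // x.
  by rewrite /= !col_form_scalar mulrDr.
have psi_tens t : psi (cJ (dl F0 *m t%:M)) =
    tlift (fun (a : A) (b : A^c) => (b : A) * c * nu a) t.
  rewrite {1}[t]tensor_sum (big_morph (fun t => psi (cJ (dl F0 *m t%:M))) psiD psi0).
  by apply: eq_bigr => p _; apply: psi_etens.
have psi_cohom t t' G : dl F0 *m t%:M = dl F0 *m t'%:M + dl (prev_diff Df d) *m G ->
    psi (cJ (dl F0 *m t%:M)) = psi (cJ (dl F0 *m t'%:M)).
  move=> e; apply: (ext_class_cohomologous (h := cJ (dl (prev_diff Df d) *m G)) ecJ) => //.
    by apply/cobJ; exists G.
  by move=> x; rewrite /= e col_formD.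
(* Over [A] the cocycle [F0 a] is cohomologous to [pi0(a) F0]. Applying [diag_env] keeps them
   cohomologous, and the relation compares their classes under [psi]. *)
have rel a : tlift (fun x y => S y * c * nu x) (D a) = (pi0 a : K) *: c.
  have [|G GE] := cohomP (F0 *m a%:M); first by rewrite mulmxA DF0 mul0mx.
  move: GE; rewrite F0act => /(congr1 dl).
  rewrite map_mxD !map_mxM !map_scalar_mx => /psi_cohom.
  rewrite psi_tens /= diag_envZ1 -etens11 -etensZr psi_etens rmorph1 mulr1 -scalerAl mul1r => <-.
  rewrite [in RHS]/diag_env linear_tlift; last first.
    by move=> u x y; apply: tliftP; multilinear.
  by apply: eq_tlift => x y; rewrite tlift_tens //; multilinear.
exists c.
have [g cg gE] := ext_class_surj ecJ 1.
pose Y : 'cV[envelop A]_(rank1 r d) := \col_i (g (delta_mx 0 i) : envelop A).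
have gY : g =1 cJ Y by exact: (linear_col_form g).
have cY : cocycle (cJ Y) by move=> q; rewrite -gY cg.
have psiY : psi (cJ Y) = 1 by rewrite -gE; apply: ext_class_eq ecJ cg gY.
have DY : dl (Df d) *m Y = 0 by apply/cocJ.
(* By [cohomP] every cocycle column lies in the image of [fk], so [fk] followed by [Df d] splits
   over [k]. *)
pose fk (z : (K^o * kmx A (prev_rank r d) 1)%type) : kmx A (rank1 r d) 1 :=
  F0 *m ((z.1 : K)%:A)%:M + prev_diff Df d *m (z.2 : 'cV_(prev_rank r d)).
pose fF := linear_of (kmx_scalar_linear F0).
have fkL : linear fk.
  move=> u x y; rewrite /fk [X in X + _ = _](kmx_scalar_linear F0 u x.1 y.1).
  rewrite [X in _ + X = _](kmx_mull_linear (prev_diff Df d) u x.2 y.2).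
  by rewrite [in RHS]scalerDr addrACA.
have [|s [t st]] := @linear_exact_split K _ _ _ (linear_of fkL)
    (kmx_mull 1 (Df d)).
  move=> y /cohomP[G GE]; exists ((phi (cP y) : K^o), (G : kmx A _ 1)).
  by rewrite /= /fk -GE.
have fstL : linear ((fun y => (s y).1) : kmx A (rank1 r d) 1 -> K^o).
  by move=> u x y; rewrite linearP.
have sndL : linear ((fun y => (s y).2) : kmx A (rank1 r d) 1 -> kmx A _ 1).
  by move=> u x y; rewrite linearP.
(* The identity is [h1 + h2 + h3]: a scalar multiple of [F0], a coboundary, and a map factoring
   through [Df d] whose extension vanishes on the cocycle [Y]. *)
pose h1 := fF \o linear_of fstL.
pose h2 := kmx_mull 1 (prev_diff Df d) \o linear_of sndL.
pose h3 := t \o kmx_mull 1 (Df d).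
have [v vE] := @col_mx_ext_scalar _ _ H _ _ h1 (linear_of fstL) F0 Y fstL (fun=> erefl).
have YE : Y = dl F0 *m (etens 1 v)%:M + dl (prev_diff Df d) *m col_mx_ext H (linear_of sndL) Y.
  rewrite -vE -{1}[Y](@col_mx_ext_id _ _ H _ idfun) //.
  rewrite (@col_mx_extD _ _ H _ _ idfun h1 (h2 \+ h3)); last first.
    by move=> y; rewrite [LHS]st addrA.
  rewrite (@col_mx_extD _ _ H _ _ (h2 \+ h3) h2 h3) //.
  rewrite (@col_mx_ext_mull _ _ H _ _ _ (linear_of sndL) h2 (prev_diff Df d)) //.
  by rewrite (@col_mx_ext_shift _ _ H _ _ _ t h3 (Df d)) // DY col_mx_ext0 addr0.
(* Taking classes in [YE], the class 1 of [Y] equals that of [diag_env F0] times [1 (x) v], which is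
   [v * c]. *)
exists v; split=> //.
have := @ext_class_cohomologous _ _ _ _ _ _ _ _ _ _ (cJ (dl F0 *m (etens 1 v)%:M)) (cJ Y)
  (cJ (dl (prev_diff Df d) *m col_mx_ext H (linear_of sndL) Y)) ecJ (cdlF0 _).
rewrite psiY psi_etens rmorph1 mulr1 => -> //; first by apply/cobJ; eexists.
by move=> x; rewrite /= -col_formD -YE.
Qed.

(** Substituting the relation for [pi0(a_1) c] turns [S^2(xi a) c] into the sum of the
    [S^2(a_3) S(a_2) c nu(a_1)], which collapses to [c nu(a)]; the one-sided inverse of [c] is
    two-sided by the chain condition. *)
Lemma nakayama_winding : exists u v : A, [/\ u * v = 1, v * u = 1 &
  forall a, nu a = u * S (S (left_winding H pi0 a)) * v].
Proof.
have [c [v [vc rel]]] := nakayama_integral_relation.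
have cv := noetherian_mulr_eq1 noeth vc.
exists v, c; split=> // a.
suff : S (S (left_winding H pi0 a)) * c = c * nu a.
  by move=> e; rewrite -mulrA e mulrA vc mul1r.
transitivity (tlift (fun x y => tlift (fun u w => S (S y) * S w * c * nu u) (D x)) (D a)).
  rewrite /left_winding !linear_tlift; try exact: linearP.
  rewrite mulr_tliftl; apply: eq_tlift => x y.
  transitivity (S (S y) * ((pi0 x : K) *: c)).
    by rewrite !linearZ /= -scalerAl -scalerAr.
  by rewrite -rel mulr_tliftr; apply: eq_tlift => u w; rewrite !mulrA.
rewrite (@coassoc _ _ H _ (fun u w y => S (S y) * S w * c * nu u)); last by multilinear.
rewrite -{2}(counitr H a) linear_tlift ?mulr_tliftr; last by move=> ? ? ?; rewrite linearP.
apply: eq_tlift => x z.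
rewrite linearZ /= -scalerAr.
transitivity (tlift (fun w y => S (S y) * S w) (D z) * (c * nu x)).
  by rewrite mulr_tliftl; apply: eq_tlift => w y; rewrite !mulrA.
by rewrite antipode2l -scalerAl mul1r.
Qed.

End Winding.

(** * Twisting by the antipode *)

Section TwistResolution.
Variables (R : pzRingType) (tau tau' : {rmorphism R -> R}).
Hypotheses (tauK : cancel tau tau') (tauK' : cancel tau' tau).

Lemma restrict_linear (S T : pzRingType) (f : {rmorphism S -> T}) (X Y : lmodType T)
  (h : {linear X -> Y}) : linear (h : restrict f X -> restrict f Y).
Proof. by move=> c x y; exact: linearP. Qed.

Definition restrict_map S T f X Y h := linear_of (@restrict_linear S T f X Y h).

Lemma untwist_linear (X Y : lmodType R) (h : {linear restrict tau X -> Y}) :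
  linear (h : X -> restrict tau' Y).
Proof.
move=> c x y; rewrite restrictZE -linearP; congr (h (_ + _ : X)).
by rewrite restrictZE tauK'.
Qed.

Lemma twist_linear (X Y : lmodType R) (h : {linear X -> restrict tau' Y}) :
  linear (h : restrict tau X -> Y).
Proof.
move=> c x y; rewrite restrictZE -[LHS]/(h (tau c *: (x : X) + y)) linearP.
by rewrite restrictZE tauK.
Qed.

(** Restriction along [tau'] turns a lifting problem for the twisted module into one for [P]. *)
Lemma restrict_projective (P : lmodType R) :
  projective P -> projective (restrict tau P).
Proof.
move=> projP X Y g f gsurj.
have [h hE] := projP _ _ (restrict_map tau' g) (linear_of (untwist_linear f)) gsurj.
by exists (linear_of (twist_linear h)).
Qed.

Variables (M : lmodType R) (Q : proj_resolution M) (theta theta' : M -> M).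
Hypotheses (thetaK : cancel theta theta') (thetaK' : cancel theta' theta)
  (theta'_linear : linear (theta' : restrict tau M -> M)).

(** Restriction along an automorphism leaves kernels and images unchanged; the augmentation is
    corrected by the semilinear bijection [theta'] so that [M] itself is resolved again. *)
Definition twist_resolution : proj_resolution M.
refine (@ProjResolution R M (fun n => restrict tau (Q n))
  (fun n => restrict_map tau (pdiff Q n))
  (linear_of theta'_linear \o restrict_map tau (paug Q)) _ _ _ _).
- by move=> n; apply: restrict_projective; apply: pres_projective.
- by move=> m; have [p pE] := paug_surj Q (theta m); exists p; rewrite /= pE thetaK.
- move=> p; have theta0 : theta' 0 = 0 by exact: (linear0 (linear_of theta'_linear)).
  split=> [/(congr1 theta)|pq] /=.
    by rewrite thetaK' -{1}theta0 thetaK' => /pres_exact0.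
  by have /pres_exact0 -> := pq.
- by move=> n p; exact: pres_exact.
Defined.

(** A scalar [c] acts on the twisted module as [tau c], and [tau'] on the values turns it back into
    [c]. *)
Lemma twist_form_linear n (f : {linear Q n -> R^o}) :
  linear ((fun q => tau' (f q)) : twist_resolution n -> R^o).
Proof.
move=> c x y; rewrite -[X in f X]/(tau c *: (x : Q n) + (y : Q n)).
by rewrite linearP rmorphD rmorphM tauK.
Qed.

Lemma untwist_form_linear n (f : {linear twist_resolution n -> R^o}) :
  linear ((fun q => tau (f q)) : Q n -> R^o).
Proof.
move=> c x y.
rewrite [X in f X](_ : _ = tau' c *: (x : restrict tau (Q n)) + y); last first.
  by rewrite restrictZE tauK'.
by rewrite linearP rmorphD rmorphM tauK'.
Qed.

Definition twist_form n f : {linear twist_resolution n -> R^o} :=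
  linear_of (@twist_form_linear n f).
Definition untwist_form n f : {linear Q n -> R^o} :=
  linear_of (@untwist_form_linear n f).

Lemma twist_form_cocycle n (f : {linear Q n -> R^o}) :
  cocycle f -> cocycle (twist_form f).
Proof. by move=> cf q; rewrite /= cf rmorph0. Qed.

Lemma untwist_form_cocycle n (f : {linear twist_resolution n -> R^o}) :
  cocycle f -> cocycle (untwist_form f).
Proof. by move=> cf q; rewrite /= [f _]cf rmorph0. Qed.

Lemma twist_form_coboundary n (f : {linear Q n -> R^o}) :
  coboundary f -> coboundary (twist_form f).
Proof.
case: n f => [|n] f /= bf; first by move=> x; rewrite bf rmorph0.
by have [g gE] := bf; exists (twist_form g) => x; rewrite /= gE.
Qed.

End TwistResolution.

(** * The centre and the antipode acting on Ext of the bimodule *)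

Section Twist.
Variables (K : fieldType) (A : algType K) (H : hopf_structure A) (d : nat).
Variable nu : {lrmorphism A -> A}.
Hypothesis nak_nu : nakayama_automorphism d nu.
Local Notation S := (antipode H).

Lemma mulr_form_linear (R : pzRingType) (X : lmodType R) (f : {linear X -> R^o}) (t : R) :
  linear ((fun x => f x * t) : X -> R^o).
Proof. by move=> c x y; rewrite linearP mulrDl /= -mulrA. Qed.

Definition mulr_form (R : pzRingType) (X : lmodType R) (f : {linear X -> R^o}) t
  : {linear X -> R^o} := linear_of (@mulr_form_linear R X f t).

(** The element [t = z (x) 1 - 1 (x) z] is central in [envelop A] and kills the bimodule [A], so
    multiplication by [t] on a resolution covers zero and [f t] is a coboundary. Hence [f (z (x) 1)]
    and [f (1 (x) z)], of classes [nu z] and [z], agree in Ext. *)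
Lemma nakayama_center z : (forall b, z * b = b * z) -> nu z = z.
Proof.
move=> cz; have [_ _ [Q [psi [psiD psiT psiS psi0]]]] := nak_nu.
have ec : ext_class
  (fun (p : A * A) (y : (envelop A)^o) => y * tens p.2 (p.1 : A^c))
  (fun p m => p.1 * m * nu p.2) psi by split.
have [f cf f1] := ext_class_surj ec 1.
have cfM t : cocycle (mulr_form f t) by move=> q; rewrite /= cf mul0r.
have psiE a b : psi (mulr_form f (etens a b)) = b * nu a.
  by rewrite (ext_class_act ec (t := (b, a)) (f := f)) // f1 mulr1.
have lmull (u : envelop A) : linear (fun y : envelop A => u * y) by multilinear.
have lmulr (u : envelop A) : linear (fun y : envelop A => y * u) by multilinear.
pose t : envelop A := etens z 1 - etens 1 z.
have comm_t y : t * y = y * t.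
  apply: (@envelop_ext K A _ (fun y => t * y) (fun y => y * t)) => [||a b].
  - exact: lmull.
  - exact: lmulr.
  by rewrite /t mulrBl mulrBr !etensM !mul1r !mulr1 !cz.
have tL n : linear ((fun q => t *: q) : Q n -> Q n).
  by move=> c x y; rewrite scalerDr !scalerA comm_t.
have cob : coboundary (mulr_form f t).
  apply: (@cocycle_coboundary_of_null _ _ _ Q Q _ (fun n => linear_of (tL n)) _ f) => //.
  - by move=> n p /=; rewrite linearZ.
  - move=> p /=; rewrite linearZ /=.
    apply: etrans (_ : bimod_scale (etens z 1) (paug Q p) - bimod_scale (etens 1 z) (paug Q p) = 0).
      by rewrite /t scalerBl.
    by rewrite !bimod_scale_etens mulr1 mul1r cz subrr.
  - by move=> p; rewrite /= linearZ; exact: esym (comm_t _).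
have := ext_class_cohomologous (g := mulr_form f (etens z 1)) ec (cfM (etens 1 z)) cob.
rewrite !psiE mul1r rmorph1 mulr1; apply=> x /=.
by rewrite /t -mulrDr addrC subrK.
Qed.

(** Twisting by [a (x) b |-> S b (x) S a] yields another resolution of [A], on which the generating
    cocycle [f] becomes one of class [g]. The twist exchanges the two sides of the bimodule Ext, and
    comparing both actions gives the relation, with [g] as the conjugating unit. *)
Lemma nakayama_antipode (T : A -> A) : left_noetherian A ->
  cancel S T -> cancel T S ->
  exists u v : A, [/\ u * v = 1, v * u = 1 & forall a, T a = u * nu (T (nu a)) * v].
Proof.
move=> noeth SK TK.
have TL : linear T.
  by move=> c x y; apply: (can_inj SK); rewrite TK linearP !TK.
have TM a b : T (a * b) = T b * T a.
  by apply: (can_inj SK); rewrite antipodeM !TK.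
have T1 : T 1 = 1 by apply: (can_inj SK); rewrite TK antipode1.
pose flip (s : {linear A -> A}) (t : envelop A) : envelop A :=
  tlift (fun (a : A) (b : A^c) => etens (s (b : A)) (s a)) t.
have flip_etens s a b : flip s (etens a b) = etens (s b) (s a).
  by apply: tlift_tens; multilinear.
have flipL s : linear (flip s) by move=> u x y; apply: tliftP; multilinear.
have flipM (s : {linear A -> A}) : s 1 = 1 -> (forall a b, s (a * b) = s b * s a) ->
    monoid_morphism (flip s).
  move=> s1 sM; split; first by rewrite -etens11 flip_etens s1.
  move=> x y; apply: (@envelop_ext K A _ (fun x => flip s (x * y))
    (fun x => flip s x * flip s y)) => [u w z|u w z|a b].
  - by rewrite mulrDl tensor_scaleAl flipL.
  - by rewrite flipL mulrDl tensor_scaleAl.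
  apply: (@envelop_ext K A _ (fun y => flip s (etens a b * y))
    (fun y => flip s (etens a b) * flip s y)) => [u w z|u w z|c e].
  - by rewrite mulrDr tensor_scaleAr flipL.
  - by rewrite flipL mulrDr tensor_scaleAr.
  by rewrite etensM !flip_etens etensM !sM.
pose T' : {linear A -> A} := linear_of TL.
have flipK (s s' : {linear A -> A}) : cancel s s' -> cancel (flip s) (flip s').
  move=> ss'; apply: (@envelop_ext K A _ (fun t => flip s' (flip s t)) id) => //.
  - by move=> u x y; rewrite !flipL.
  - by move=> a b; rewrite !flip_etens !ss'.
pose mk (s : {linear A -> A}) s1 sM : {rmorphism envelop A -> envelop A} :=
  HB.pack (flip s) (GRing.isLinear.Build K _ _ *:%R (flip s) (flipL s))
    (GRing.isMonoidMorphism.Build _ _ (flip s) (flipM s s1 sM)).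
pose tau := mk S (antipode1 H) (antipodeM H).
pose tau' := mk T' T1 TM.
have tauK : cancel tau tau' by exact: flipK.
have tauK' : cancel tau' tau by exact: flipK.
have thL : linear (T : restrict tau (bimod A) -> bimod A).
  move=> u x y; rewrite restrictZE.
  rewrite -[LHS]/(T' (bimod_scale (tau u) x + y)) linearD; congr (_ + _ : A).
  apply: (@envelop_ext K A _ (fun u => T' (bimod_scale (flip S u) x))
    (fun u => bimod_scale u (T x))) => [v w z|v w z|a b].
  - by rewrite flipL bimod_scale_lin linearP.
  - by rewrite bimod_scale_lin.
  by rewrite flip_etens !bimod_scale_etens /= !TM !SK mulrA.
have [_ _ nakE] := nak_nu.
have [Q [psi [psiD psiT psiS psi0]]] := nakE.
have ec : ext_class
  (fun (p : A * A) (y : (envelop A)^o) => y * tens p.2 (p.1 : A^c))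
  (fun p m => p.1 * m * nu p.2) psi by split.
pose Q' := twist_resolution tauK tauK' Q SK TK thL.
have [phi ec'] := Ext_iso_any Q' nakE.
have [f cf f1] := ext_class_surj ec 1.
pose tw (h : {linear Q d -> (envelop A)^o}) : {linear Q' d -> (envelop A)^o} :=
  @twist_form _ _ _ tauK tauK' _ Q _ _ SK TK thL d h.
have ctw h : cocycle h -> cocycle (tw h) by exact: twist_form_cocycle.
have cfM t : cocycle (mulr_form f t) by move=> q; rewrite /= cf mul0r.
have psiE a b : psi (mulr_form f (etens a b)) = b * nu a.
  by rewrite (ext_class_act ec (t := (b, a)) (f := f)) // f1 mulr1.
pose g := phi (tw f).
have phiE a b : phi (tw (mulr_form f (etens a b))) = T a * g * nu (T b).
  apply: (ext_class_act ec' (t := (T a, T b)) (f := tw f)); first exact: ctw.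
  move=> x; apply: etrans (rmorphM tau' (f x) (etens a b)) _.
  by congr (_ * _); exact: (flip_etens T').
(* Twisting preserves coboundaries, hence descends to classes. *)
have phi_wd h h' : cocycle h -> cocycle h' -> psi h = psi h' -> phi (tw h) = phi (tw h').
  move=> ch ch' e; pose b : {linear Q d -> (envelop A)^o} := h \- h'.
  have cb : cocycle b by move=> q; rewrite /= ch ch' subrr.
  have bb : coboundary b.
    apply/(ext_class_eq0 ec cb); apply: (addIr (psi h')); rewrite add0r -[in RHS]e.
    by symmetry; apply: (ext_classD ec) => // x; rewrite /= subrK.
  apply: (ext_class_cohomologous (h := tw b) ec'); first exact: ctw.
    exact: twist_form_coboundary.
  move=> x; have hE : h x = h' x + b x by rewrite /= addrC subrK.
  exact: etrans (congr1 tau' hE) (rmorphD tau' _ _).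
(* The cocycles [f (a (x) 1)] and [f (1 (x) nu a)] both have class [nu a], so their twists have
   equal classes. *)
have rel a : T a * g = g * nu (T (nu a)).
  have := phi_wd _ _ (cfM (etens a 1)) (cfM (etens 1 (nu a))).
  by rewrite !psiE !phiE T1 !rmorph1 !mul1r !mulr1; apply.
(* Untwisting a cocycle of class 1 gives a multiple of the generator up to a coboundary, hence a
   right inverse of [g]. *)
have [h' ch' h'E] := ext_class_surj ec' 1.
pose h : {linear Q d -> (envelop A)^o} :=
  @untwist_form _ _ _ tauK tauK' _ Q _ _ SK TK thL d h'.
have ch : cocycle h by exact: untwist_form_cocycle.
pose w := nu (T (psi h)).
have gw : g * w = 1.
  have := phi_wd _ _ (cfM (etens 1 (psi h))) ch.
  rewrite psiE phiE T1 rmorph1 mulr1 mul1r => -> //; rewrite -h'E.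
  by apply: ext_class_eq ec' ch' _ => x; symmetry; exact: (tauK (h' x)).
have wg := noetherian_mulr_eq1 noeth gw.
by exists g, w; split=> // a; rewrite -rel -mulrA gw mulr1.
Qed.

End Twist.

(** * Orders modulo inner automorphisms *)

Section InnerEquality.
Variable R : pzRingType.
Implicit Types f g h : R -> R.

Definition inner_eq f g : Prop :=
  exists u v : R, [/\ u * v = 1, v * u = 1 & forall a, f a = u * g a * v].

Lemma inner_eq_refl f : inner_eq f f.
Proof. by exists 1, 1; split=> [||a]; rewrite ?mulr1 ?mul1r. Qed.

Lemma inner_eqW f g : f =1 g -> inner_eq f g.
Proof. by move=> fg; exists 1, 1; split=> [||a]; rewrite ?mulr1 ?mul1r ?fg. Qed.

Lemma inner_eq_sym f g : inner_eq f g -> inner_eq g f.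
Proof.
move=> [u [v [uv vu fE]]]; exists v, u; split=> // a.
by rewrite fE !mulrA vu mul1r -mulrA vu mulr1.
Qed.

Lemma inner_eq_trans g f h : inner_eq f g -> inner_eq g h -> inner_eq f h.
Proof.
move=> [u [v [uv vu fE]]] [u' [v' [uv' vu' gE]]].
exists (u * u'), (v' * v); split=> [||a].
- by rewrite mulrA -[u * u' * v']mulrA uv' mulr1.
- by rewrite mulrA -[v' * v * u]mulrA vu mulr1.
- by rewrite fE gE !mulrA.
Qed.

(** The condition under which composing with [h] on the left respects [inner_eq], which is defined
    for arbitrary functions. Homomorphisms and antihomomorphisms satisfy it. *)
Definition preserves_inner h : Prop :=
  forall u v : R, u * v = 1 -> v * u = 1 ->
  exists u' v' : R, [/\ u' * v' = 1, v' * u' = 1 & forall a, h (u * a * v) = u' * h a * v'].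

Lemma inner_eq_comp f f' g g' : preserves_inner f ->
  inner_eq f f' -> inner_eq g g' -> inner_eq (f \o g) (f' \o g').
Proof.
move=> pf ff' [u [v [uv vu gE]]]; apply: (@inner_eq_trans (f \o g')).
  have [u' [v' [uv' vu' fE]]] := pf u v uv vu.
  by exists u', v'; split=> // a /=; rewrite gE fE.
have [w [z [wz zw fE]]] := ff'.
by exists w, z; split=> // a /=; rewrite fE.
Qed.

Lemma preserves_inner_comp f g :
  preserves_inner f -> preserves_inner g -> preserves_inner (f \o g).
Proof.
move=> pf pg u v uv vu; have [u' [v' [uv' vu' gE]]] := pg u v uv vu.
have [w [z [wz zw fE]]] := pf u' v' uv' vu'.
by exists w, z; split=> // a /=; rewrite gE fE.
Qed.

Lemma preserves_inner_iter n f : preserves_inner f -> preserves_inner (iter n f).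
Proof.
move=> pf; elim: n => [|n ih]; first by move=> u v uv vu; exists u, v.
exact: preserves_inner_comp.
Qed.

Lemma preserves_inner_morph f : f 1 = 1 -> {morph f : x y / x * y} ->
  preserves_inner f.
Proof.
move=> f1 fM u v uv vu; exists (f u), (f v).
by split=> [||a]; rewrite -?fM ?uv ?vu ?f1 // !fM.
Qed.

Lemma preserves_inner_anti f : f 1 = 1 -> (forall x y, f (x * y) = f y * f x) ->
  preserves_inner f.
Proof.
move=> f1 fM u v uv vu; exists (f v), (f u).
by split=> [||a]; rewrite -?fM ?uv ?vu ?f1 // !fM mulrA.
Qed.

Local Hint Resolve inner_eq_refl preserves_inner_comp preserves_inner_iter
  inner_eq_comp : core.

Lemma inner_eq_comm_iter n f g : preserves_inner f -> preserves_inner g ->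
  inner_eq (f \o g) (g \o f) -> inner_eq (f \o iter n g) (iter n g \o f).
Proof.
move=> pf pg fg; elim: n => [|n ih]; first exact: inner_eq_refl.
apply: (@inner_eq_trans (g \o (f \o iter n g))).
  by apply: (@inner_eq_comp (f \o g) (g \o f) (iter n g) (iter n g)); auto.
by apply: (@inner_eq_comp g g); auto.
Qed.

(* Modulo inner automorphisms the hypotheses read [nu = S^2 xi] and           *)
(* [S nu S^-1 = nu^-1].                                                       *)
Lemma inner_order (S T nu mu xi : R -> R) m :
  cancel S T -> cancel T S -> cancel nu mu -> cancel mu nu ->
  preserves_inner S -> preserves_inner T ->
  preserves_inner nu -> preserves_inner mu ->
  inner_eq nu (S \o (S \o xi)) -> inner_eq T (nu \o (T \o nu)) ->
  iter m xi =1 id ->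
  inner_eq (iter (4 * m) S) id /\ inner_eq (iter (2 * m) nu) id.
Proof.
move=> SK TK nuK muK pS pT pnu pmu nuE TE xim.
have rf := inner_eq_refl.
have pc := preserves_inner_comp.
pose q := S \o S.
have pq : preserves_inner q by exact: pc.
(* Modulo inner automorphisms, conjugation by [S] inverts [nu]; it sends [mu] back to [nu], so
   [q = S^2] commutes with [nu]. *)
have SnT : inner_eq (S \o (nu \o T)) mu.
  have e : inner_eq (S \o T \o mu) (S \o (nu \o (T \o nu)) \o mu).
    by auto.
  apply: inner_eq_sym; apply: (inner_eq_trans (g := S \o T \o mu)).
    by apply: inner_eqW => a /=; rewrite TK.
  apply: (inner_eq_trans e); apply: inner_eqW => a /=.
  by rewrite muK.
have SmT : inner_eq (S \o (mu \o T)) nu.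
  have e : inner_eq (S \o mu \o T) (S \o mu \o (nu \o (T \o nu))).
    by auto.
  apply: (inner_eq_trans e); apply: inner_eqW => a /=.
  by rewrite nuK TK.
have nuq : inner_eq (nu \o q) (q \o nu).
  have e : inner_eq (S \o (S \o (nu \o T)) \o T) (S \o mu \o T).
    by auto.
  have e' := inner_eq_trans e SmT.
  have := inner_eq_comp _ (inner_eq_sym e') (rf q).
  move=> /(_ pnu) e2; apply: (inner_eq_trans e2); apply: inner_eqW => a /=.
  by rewrite !SK.
(* The new factor [nu] is moved past [q^n] before it is expanded as [q xi]; only the commutation of
   [nu] with [q] enters. *)
have qxi n : inner_eq (iter n nu) (iter n q \o iter n xi).
  elim: n => [|n ih]; first exact: rf.
  have e1 : inner_eq (nu \o iter n nu) (nu \o iter n q \o iter n xi).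
    exact: (inner_eq_comp pnu (rf nu) ih).
  apply: (inner_eq_trans e1).
  have e2 : inner_eq (nu \o iter n q \o iter n xi) (iter n q \o nu \o iter n xi).
    by apply: inner_eq_comp; auto; apply: inner_eq_comm_iter.
  apply: (inner_eq_trans e2).
  have e3 : inner_eq (iter n q \o (nu \o iter n xi))
                     (iter n q \o ((S \o (S \o xi)) \o iter n xi)).
    by auto.
  apply: (inner_eq_trans e3); apply: inner_eqW => a /=.
  by rewrite -iterSr.
have qnu : inner_eq (iter m q) (iter m nu).
  apply: inner_eq_sym; apply: (inner_eq_trans (qxi m)).
  by apply: inner_eqW => a /=; rewrite xim.
(* Conjugation by [S] fixes [q^m] and turns [nu^m] into [mu^m]. Thus [q^m] equals both, and [q^(2m)]
   equals [nu^m mu^m = 1]. *)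
have qmu : inner_eq (iter m q) (iter m mu).
  have e : inner_eq (S \o (iter m q \o T)) (S \o (iter m nu \o T)).
    by auto.
  have eq1 : S \o (iter m q \o T) =1 iter m q.
    move=> a /=; have -> : S (iter m q (T a)) = iter m q (S (T a)).
      by elim: (m) => // n ih; rewrite !iterS -ih.
    by rewrite TK.
  apply: (inner_eq_trans (inner_eq_sym (inner_eqW eq1))).
  apply: (inner_eq_trans e).
  elim: (m) => [|n ih]; first by apply: inner_eqW => a /=; rewrite TK.
  apply: (@inner_eq_trans ((S \o (nu \o T)) \o (S \o (iter n nu \o T)))).
    by apply: inner_eqW => a /=; rewrite SK.
  by apply: (@inner_eq_comp _ mu _ (iter n mu)); auto.
have q2 : inner_eq (iter (2 * m) q) id.
  apply: (@inner_eq_trans (iter m nu \o iter m mu)).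
    rewrite mul2n -addnn.
    apply: (@inner_eq_trans (iter m q \o iter m q)).
      by apply: inner_eqW => a; rewrite iterD.
    by auto.
  apply: inner_eqW => a /=.
  by elim: (m) a => //= n ih a; rewrite -iterS iterSr muK ih.
split.
  apply: inner_eq_trans q2; apply: inner_eqW => a.
  have it n : iter (2 * n) S a = iter n q a.
    by elim: n => // n ih; rewrite mulnS [LHS]/= ih.
  by rewrite -[4%N]/(2 * 2)%N -mulnA it.
apply: inner_eq_trans q2.
apply: (inner_eq_trans (qxi _)); apply: inner_eqW => a /=.
by congr (iter _ q _); rewrite mul2n -addnn iterD !xim.
Qed.

End InnerEquality.

(** * Independence of characters *)

Section Characters.
Variables (K : fieldType) (A : algType K).

Lemma char_inner (chi : {lrmorphism A -> K^o}) u v a :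
  u * v = 1 -> chi (u * a * v) = chi a.
Proof.
move=> uv; rewrite !rmorphM.
transitivity ((chi u : K) * chi v * chi a); first by rewrite -mulrA [X in _ * X = _]mulrC mulrA.
have -> : (chi u : K) * chi v = 1 by apply: etrans (esym (rmorphM chi u v)) _; rewrite uv rmorph1.
by rewrite mul1r.
Qed.

(** Dedekind's argument, by induction on the support [B]: subtracting [chi j a] times the relation
    at [x] from the relation at [a * x] removes the term [j], and [a] is chosen so that the term [i]
    survives. *)
Lemma char_independent n (chi : 'I_n -> {lrmorphism A -> K^o}) (c : 'I_n -> K)
    (B : {set 'I_n}) :
  (forall i j, i != j -> exists a, chi i a <> chi j a) ->
  (forall a, \sum_(i in B) c i * (chi i a : K) = 0) ->
  forall i, i \in B -> c i = 0.
Proof.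
move=> dist.
elim: {B}#|B| {-2}B (erefl #|B|) c => [|m ih] B cB c cchi i iB.
  by move: iB; rewrite (cards0_eq cB) inE.
have [[j jB ji]|nj] := pselect (exists2 j, j \in B & j != i); last first.
  have := cchi 1; rewrite (bigD1 i) //= rmorph1 mulr1 big1 ?addr0 // => j /andP[jB ji].
  by case: nj; exists j.
have [a aE] := dist _ _ ji.
have cBj : #|B :\ j| = m by apply/eqP; rewrite -eqSS -cB (cardsD1 j B) jB.
have ca0 : (chi i a : K) - chi j a != 0 by rewrite subr_eq0 eq_sym; apply/eqP.
apply/eqP; have : c i * ((chi i a : K) - chi j a) = 0.
  apply: (ih _ cBj (fun l => c l * ((chi l a : K) - chi j a))); last first.
    by rewrite !inE eq_sym ji.
  move=> x; have : \sum_(l in B) c l * (chi l (a * x) : K)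
      - (chi j a : K) * \sum_(l in B) c l * (chi l x : K) = 0.
    by rewrite !cchi mulr0 subrr.
  rewrite mulr_sumr -sumrB (bigD1 j) //=.
  have chiM l : chi l (a * x) = (chi l a : K) * chi l x by exact: rmorphM.
  rewrite chiM mulrCA subrr add0r => sum0; rewrite -[RHS]sum0.
  apply: eq_big => [l|l _]; first by rewrite !inE andbC.
  by rewrite chiM mulrBr mulrBl !mulrA [(chi j a : K) * c l]mulrC.
by move/eqP; rewrite mulf_eq0 (negbTE ca0) orbF.
Qed.

End Characters.

(** * Characters and winding automorphisms *)

Section Winding.
Variables (K : fieldType) (A : algType K) (H : hopf_structure A).
Local Notation S := (antipode H).
Local Notation D := (comul H).

(** Both [chi] and [chi S^2] are convolution inverses of [chi S]; the proof evaluates their triple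
    convolution in two ways. *)
Lemma char_antipode2 (chi : {lrmorphism A -> K^o}) a : chi (S (S a)) = chi a.
Proof.
pose F x y w : K^o := (chi x : K) * chi (S y) * chi (S (S w)).
have FL : is_trilinear F.
  by split=> u; apply: bilinearI => v c x y; rewrite /F ?linearP /GRing.scale /=; ring.
have := coassoc H a FL.
transitivity (tlift (fun x z => tlift (fun x' y => F x' y z) (D x)) (D a)).
  rewrite -{1}(counitl H a) !linear_tlift; try exact: linearP.
  apply: eq_tlift => x w; rewrite !linearZ.
  transitivity (chi (tlift (fun x y => x * S y) (D x)) * chi (S (S w)) : K).
    by rewrite antipoder linearZ /= rmorph1 [_ *: 1]mulr1.
  rewrite linear_tlift; last exact: linearP.
  rewrite /tlift /eval_formal mulr_suml; apply: eq_bigr => p _.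
  by rewrite rmorphM.
rewrite coassoc // -{2}(counitr H a) linear_tlift; last exact: linearP.
apply: eq_tlift => x z; rewrite linearZ.
transitivity (chi x * chi (tlift (fun y w => S (S w) * S y) (D z)) : K).
  rewrite linear_tlift; last exact: linearP.
  rewrite /tlift /eval_formal mulr_sumr; apply: eq_bigr => p _.
  by rewrite rmorphM /F -mulrA; congr (_ * _); exact: mulrC.
rewrite antipode2l linearZ /= rmorph1 [_ *: 1]mulr1; exact: mulrC.
Qed.

Variable pi0 : {lrmorphism A -> K^o}.
Local Notation xi := (left_winding H pi0).

Lemma left_winding_linear : linear xi.
Proof.
apply: linear_tlift_arg; split=> c x y z.
  by rewrite linearP scalerDl scalerA.
by rewrite scalerDr !scalerA mulrC.
Qed.

Lemma iter_winding_linear n : linear (iter n xi).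
Proof.
elim: n => // n ih c x y.
exact: etrans (congr1 xi (ih c x y)) (left_winding_linear c _ _).
Qed.

(** The power [xi^n] is the winding by the character [eps xi^n], and so is determined by that
    character. *)
Lemma counit_winding_iter n a :
  tlift (fun x y => (counit H (iter n xi x) : K) *: y) (D a) = iter n xi a.
Proof.
elim: n a => [|n ih] a; first exact: counitl.
pose X := linear_of (iter_winding_linear n).
have XZ c x : iter n xi (c *: x) = c *: iter n xi x by rewrite -[LHS]/(X _) linearZ.
pose F x y w : A := ((pi0 x : K) * (counit H (iter n xi y) : K)) *: w.
have XP c x y : counit H (iter n xi (c *: x + y)) =
    c * (counit H (iter n xi x) : K) + counit H (iter n xi y) :> K.
  by rewrite iter_winding_linear linearP.
have FL : is_trilinear F.
  split=> u; apply: bilinearI => v c x y; rewrite /F.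
  - by rewrite XP scalerA -scalerDl; congr (_ *: _); ring.
  - by rewrite scalerDr !scalerA [c * _]mulrC.
  - by rewrite linearP scalerA -scalerDl /GRing.scale /=; congr (_ *: _); ring.
  - by rewrite XP scalerA -scalerDl; congr (_ *: _); ring.
rewrite iterSr {2}/left_winding linear_tlift; last exact: iter_winding_linear.
transitivity (tlift (fun x w => tlift (fun u y => F u y w) (D x)) (D a)).
  apply: eq_tlift => x w; rewrite iterSr {2}/left_winding.
  rewrite linear_tlift; last exact: iter_winding_linear.
  rewrite linear_tlift; last exact: linearP.
  rewrite /tlift /eval_formal scaler_suml; apply: eq_bigr => p _ /=.
  by rewrite XZ linearZ.
rewrite coassoc //; apply: eq_tlift => x z.
by rewrite XZ -ih scaler_tlift; apply: eq_tlift => u y; rewrite /F scalerA.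
Qed.

End Winding.

Lemma least_posP (P : nat -> Prop) :
  if least_pos P is Some n then
    [/\ (0 < n)%N, P n & forall m, (0 < m)%N -> P m -> (n <= m)%N]
  else forall m, (0 < m)%N -> ~ P m.
Proof.
rewrite /least_pos; case: pselect => [h|nh] /=.
  case: ex_minnP => n /andP[n0 /asboolP Pn] nmin; split=> // m m0 Pm.
  by apply: nmin; rewrite m0; apply/asboolP.
by move=> m m0 Pm; apply: nh; exists m; rewrite m0; apply/asboolP.
Qed.

Lemma iter_id_dvd (T : Type) (f : T -> T) m n :
  (forall a, iter m f a = a) -> (forall a, iter n f a = a) ->
  (forall l, (0 < l)%N -> (forall a, iter l f a = a) -> (m <= l)%N) ->
  (0 < m)%N -> (m %| n)%N.
Proof.
move=> fm fn mmin m0; apply: contraT => ndvd.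
have := mmin (n %% m)%N; rewrite lt0n => /(_ ndvd) h.
suff /h : forall a, iter (n %% m) f a = a by rewrite leqNgt ltn_mod m0.
have fmq q a : iter (q * m) f a = a.
  by elim: q => //= q ih; rewrite mulSn iterD ih.
by move=> a; rewrite -[RHS]fn {2}(divn_eq n m) addnC iterD fmq.
Qed.

(** The values of [N + 1] characters at [N] generators are linearly dependent. As the characters
    agree on the coefficients, which are central, the dependence holds on all of [A], so by
    independence two of them coincide. *)
Lemma characters_over_center (K : fieldType) (A : algType K) (chi : nat -> {lrmorphism A -> K^o}) :
  finite_over_center A ->
  (forall n z, (forall b, z * b = b * z) -> chi n z = chi 0%N z) ->
  exists i j, (i < j)%N /\ chi i =1 chi j.
Proof.
move=> [s gen] chiZ; set N := size s; apply: contrapT => nex.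
pose M : 'M[K]_(N.+1, N) := \matrix_(i, l) (chi i s`_l : K).
have kM : kermx M != 0.
  rewrite kermx_eq0; apply/negP => /eqP rM.
  by have := rank_leq_col M; rewrite rM ltnn.
pose v := nz_row (kermx M).
have vM : v *m M = 0 by apply/sub_kermxP; exact: nz_row_sub.
have v0 : v != 0 by rewrite nz_row_eq0.
have dist (i j : 'I_N.+1) : i != j -> exists a, chi i a <> chi j a.
  move=> ij; apply: contrapT => nd; apply: nex.
  have e : chi i =1 chi j by move=> a; apply: contrapT => h; apply: nd; exists a.
  case: (ltngtP i j) => [lij|lji|eij].
  - by exists i, j.
  - by exists j, i; split=> // a; rewrite e.
  - by move: ij; rewrite -val_eqE /= eij eqxx.
have vchi a : \sum_(i in [set: 'I_N.+1]) v 0 i * (chi i a : K) = 0.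
  have [z zc ->] := gen a.
  have chia (i : 'I_N.+1) : chi i (\sum_(l < N) z l * s`_l) =
      \sum_(l < N) (chi 0%N (z l) : K) * chi i s`_l :> K.
    rewrite linear_sum; apply: eq_bigr => l _.
    by rewrite -(chiZ i _ (zc l)); exact: rmorphM.
  under eq_bigr => i _ do rewrite chia mulr_sumr.
  rewrite exchange_big big1 // => l _ /=.
  have := congr1 (fun B : 'rV_N => (chi 0%N (z l) : K) * B 0 l) vM.
  rewrite !mxE mulr0 mulr_sumr => e; rewrite -[RHS]e.
  apply: eq_big => [i|i _]; first by rewrite inE.
  by rewrite mxE mulrCA.
have vi := char_independent dist vchi.
by move/eqP: v0; apply; apply/rowP => i; rewrite vi ?inE // mxE.
Qed.

(** * Orders of the winding, of the antipode and of the Nakayama automorphism *)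

Section Final.
Variables (k : fieldType) (A : algType k) (H : hopf_structure A) (d : nat).
Variables (pi0 : {lrmorphism A -> k^o}) (nu : {lrmorphism A -> A}).
Hypothesis noeth : left_noetherian A.
Hypothesis int_pi0 : integral_character (counit H) d pi0.
Hypothesis nak_nu : nakayama_automorphism d nu.
Local Notation S := (antipode H).
Local Notation xi := (left_winding H pi0).

(** Characters see neither conjugation nor [S^2], so [nu] and [xi] agree under them. The induction
    replaces [chi] by [chi \o nu], again a character, hence the quantification over [chi]. *)
Lemma char_nakayama_iter n (chi : {lrmorphism A -> k^o}) a :
  chi (iter n nu a) = chi (iter n xi a).
Proof.
have chi_nu (psi : {lrmorphism A -> k^o}) b : psi (nu b) = psi (xi b).
  have [u [v [uv _ ->]]] := nakayama_winding noeth int_pi0 nak_nu.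
  by rewrite char_inner // char_antipode2.
elim: n chi => // n ih chi.
exact: etrans (ih (chi \o nu) ) (chi_nu _ _).
Qed.

Lemma winding_iter_id n :
  (forall a, counit H (iter n nu a) = counit H a) -> forall a, iter n xi a = a.
Proof.
move=> en a; rewrite -[RHS](counitl H) -[LHS](counit_winding_iter H).
by apply: eq_tlift => x y; rewrite -char_nakayama_iter en.
Qed.

Lemma counit_inner f : is_inner f -> forall a, counit H (f a) = counit H a.
Proof. by move=> [u [v [uv _ fE]]] a; rewrite fE char_inner. Qed.

(** The characters [eps nu^n] agree on the centre, which [nu] fixes, so two of them coincide;
    cancelling the smaller power leaves [eps nu^(j-i) = eps]. *)
Lemma integral_order_finite : finite_over_center A ->
  exists2 m, (0 < m)%N & forall a, iter m xi a = a.
Proof.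
move=> fin.
pose chi := fix chi n : {lrmorphism A -> k^o} :=
  if n is m.+1 then chi m \o nu else counit H.
have chiE n a : chi n a = counit H (iter n nu a).
  by elim: n a => // n ih a; rewrite iterSr -ih.
have [|i [j [ij chij]]] := characters_over_center (chi := chi) fin.
  move=> n z cz; rewrite chiE; congr (counit H _).
  by elim: n => //= n ->; exact: (nakayama_center nak_nu cz).
have [[mu nuK muK] _ _] := nak_nu.
exists (j - i)%N; first by rewrite subn_gt0.
apply: winding_iter_id => a.
have -> : a = iter i nu (iter i mu a).
  by elim: i a {ij chij} => // i ih a; rewrite iterSr /= muK -ih.
by rewrite -iterD subnK 1?ltnW // -!chiE chij.
Qed.

Hypothesis bijS : bijective S.

Lemma inner_powers m : (forall a, iter m xi a = a) ->
  is_inner (iter (4 * m) S) /\ is_inner (iter (2 * m) nu).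
Proof.
move=> xim; have [T SK TK] := bijS; have [[mu nuK muK] _ _] := nak_nu.
have TM a b : T (a * b) = T b * T a.
  by apply: (can_inj SK); rewrite antipodeM !TK.
have T1 : T 1 = 1 by apply: (can_inj SK); rewrite TK antipode1.
have nu_inj : injective nu := can_inj nuK.
have numu a : nu (mu a) = a := muK a.
have muM (a b : A) : mu (a * b) = mu a * mu b.
  by apply: nu_inj; rewrite rmorphM /= !numu.
have mu1 : mu 1 = 1 by apply: nu_inj; rewrite numu rmorph1.
suff [] : inner_eq (iter (4 * m) S) id /\ inner_eq (iter (2 * m) nu) id by [].
apply: (@inner_order A S T nu mu xi) => //.
- exact: preserves_inner_anti (antipode1 H) (antipodeM H).
- exact: preserves_inner_anti.
- exact: preserves_inner_morph (rmorph1 nu) (rmorphM nu).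
- exact: preserves_inner_morph.
- exact: nakayama_winding noeth int_pi0 nak_nu.
- by have := nakayama_antipode nak_nu noeth SK TK.
Qed.

End Final.

Theorem corollary0p6 (k : closedFieldType) (A : algType k)
    (H : hopf_structure A) (d : nat)
    (pi0 : {lrmorphism A -> k^o}) (nu : {lrmorphism A -> A}) :
  AS_Gorenstein (counit H) d ->
  finite_gldim A ->
  bijective (antipode H) ->
  integral_character (counit H) d pi0 ->
  nakayama_automorphism d nu ->
  [/\ nakayama_order nu = integral_order H pi0 \/
      nakayama_order nu = omap (muln 2) (integral_order H pi0),
      forall n : nat, integral_order H pi0 = Some n ->
        is_inner (iter (4 * n) (antipode H))
    & finite_over_center A ->
        (exists2 m : nat, (0 < m)%N & is_inner (iter m (antipode H))) /\
        (exists2 m : nat, (0 < m)%N & is_inner (iter m nu))].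
Proof.
move=> [[noeth _] _ _] _ bijS int_pi0 nak_nu.
have inner m := inner_powers noeth int_pi0 nak_nu bijS (m := m).
have nu_xi n : is_inner (iter n nu) -> forall a, iter n (left_winding H pi0) a = a.
  move=> /(counit_inner H) h; exact: (winding_iter_id noeth int_pi0 nak_nu h).
split.
- have := least_posP (fun n => forall a, iter n (left_winding H pi0) a = a).
  have := least_posP (fun n => is_inner (iter n nu)).
  rewrite -/(nakayama_order nu) -/(integral_order H pi0).
  case: (nakayama_order nu) (integral_order H pi0) => [n|] [m|] //=.
  (* With [n] the Nakayama order and [m] the integral order, [nu^(2m)] inner gives [n <= 2m], and
     [xi^n = 1] gives that [m] divides [n]; hence [n] is [m] or [2m]. *)
  + move=> [n0 nun nmin] [m0 xim mmin].
    have n2m : (n <= 2 * m)%N.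
      by apply: nmin; [rewrite muln_gt0 m0 | exact: (inner m xim).2].
    have /dvdnP[q nE] : (m %| n)%N by apply: iter_id_dvd xim (nu_xi n nun) mmin m0.
    move: n2m n0; rewrite nE leq_pmul2r //.
    by case: q {nE} => [|[|[|q]]] // _ _; [left; rewrite mul1n | right].
  (* In the mixed cases, finiteness of either order forces finiteness of the other. *)
  + by move=> [n0 /nu_xi h _] /(_ n n0).
  + move=> h [m0 xim _]; case: (h (2 * m)%N); first by rewrite muln_gt0 m0.
    exact: (inner m xim).2.
  + by left.
- move=> n nE.
  have := least_posP (fun n => forall a, iter n (left_winding H pi0) a = a).
  by rewrite -/(integral_order H pi0) nE => -[_ /inner[]].
- move=> fin; have [m m0 /inner[i4 i2]] := integral_order_finite noeth int_pi0 nak_nu fin.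
  by split; [exists (4 * m)%N | exists (2 * m)%N]; rewrite ?muln_gt0.
Qed.
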